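(* The problems Ap-WFA continuity and Matrix Product Continuity are each algorithmically reducible to Matrix Product Stability.
   Context: Problems. Matrix Product Stability. Input: a finite set $\{A_a : a\in\Sigma\}$ of $n\times n$ matrices. Question: is it stable? Ap-WFA continuity. Input: an average preserving WFA $\mathcal{A}$. Question: is $f_{\mathcal{A}}$ everywhere continuous on $\Sigma^\omega$ (in particular everywhere defined)? Matrix Product Continuity. Input: a finite set $\{A_a : a\in\Sigma\}$ of $n\times n$ matrices. Question: is it a continuous RCP set? Definitions. $\Sigma$ is a nonempty finite alphabet, $\Sigma^*$ the set of finite words, $\Sigma^\omega$ the set of infinite words with metric $d_C(w,w')=2^{-k}$, $k$ the length of the longest common prefix of $w\neq w'$; $\mathrm{pref}_k(w)$ is the length-$k$ prefix of $w$. For $v=v_1\cdots v_k$, $A_v=A_{v_1}\cdots A_{v_k}$. A set $\{A_a: a\in\Sigma\}$ is a continuous RCP (right-convergent product) set if $A_w=\lim_{k\to\infty}A_{\mathrm{pref}_k(w)}$ exists for every $w\in\Sigma^\omega$ and $w\mapsto A_w$ is continuous on $\Sigma^\omega$; it is stable if $A_w$ exists and equals $0$ for every $w\in\Sigma^\omega$. A WFA $\mathcal{A}$ over $\Sigma$ with $n\ge0$ states consists of $I\in\mathbb{R}^{1\times n}$, $F\in\mathbb{R}^{n\times1}$ and matrices $A_a\in\mathbb{R}^{n\times n}$ ($a\in\Sigma$); its $\omega$-function is $f_{\mathcal{A}}(w)=\lim_{k\to\infty}IA_{\mathrm{pref}_k(w)}F$, undefined where the limit does not exist. It is average preserving if $\sum_{a\in\Sigma}A_aF=|\Sigma|F$.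 Conventions. All matrix entries are given so that exact addition, multiplication, division and equality testing are algorithmic (for example, rational entries). A problem $X$ is algorithmically reducible to a problem $Y$ if there is an algorithm that decides $X$ and may call a decision procedure for $Y$ finitely many times. *)

(* Defs.v *)
From HB Require Import structures.
From mathcomp Require Import all_boot all_order all_algebra.
From mathcomp Require Import all_classical all_reals all_analysis.

Set Implicit Arguments.
Unset Strict Implicit.
Unset Printing Implicit Defensive.

Import Order.TTheory GRing.Theory Num.Theory numFieldNormedType.Exports.

Local Open Scope classical_set_scope.
Local Open Scope ring_scope.

(* Data are binary trees.  Programs are those of a while language on trees
   (Turing complete), extended with one instruction that queries an oracle. *)
Inductive tree := Leaf | Node of tree & tree.

Definition left_tree t := if t is Node l _ then l else Leaf.
Definition right_tree t := if t is Node _ r then r else Leaf.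
Definition tree_of_bool (b : bool) := if b then Node Leaf Leaf else Leaf.

Inductive prog :=
| PLeaf
| PId
| PLeft
| PRight
| PNode of prog & prog
| PComp of prog & prog (* [PComp p q] runs [q] first *)
| PIf of prog & prog & prog
| PWhile of prog
| PQuery.

(* [None]: the oracle does not answer, and the querying program is stuck. *)
Definition oracle := tree -> option bool.
Definition no_oracle : oracle := fun=> None.

(* [run O p t u]: on input [t], [p] with oracle [O] halts with output [u].
   A halting run makes finitely many oracle queries.  [Leaf] is false in tests;
   [PWhile p] iterates [p] as long as the left subtree of the state is true. *)
Inductive run (O : oracle) : prog -> tree -> tree -> Prop :=
| run_leaf t : run O PLeaf t Leaf
| run_id t : run O PId t t
| run_left t : run O PLeft t (left_tree t)
| run_right t : run O PRight t (right_tree t)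
| run_node p q t u v :
    run O p t u -> run O q t v -> run O (PNode p q) t (Node u v)
| run_comp p q t u v :
    run O q t u -> run O p u v -> run O (PComp p q) t v
| run_if_true c p q t u v v' :
    run O c t (Node u v) -> run O p t v' -> run O (PIf c p q) t v'
| run_if_false c p q t v' :
    run O c t Leaf -> run O q t v' -> run O (PIf c p q) t v'
| run_while_stop p t :
    left_tree t = Leaf -> run O (PWhile p) t t
| run_while_step p t u v :
    left_tree t <> Leaf -> run O p t u -> run O (PWhile p) u v ->
    run O (PWhile p) t v
| run_query t b :
    O t = Some b -> run O PQuery t (tree_of_bool b).

Lemma run_det O p t u v : run O p t u -> run O p t v -> u = v.
Proof.
move=> r; elim: r v => {p t u}.
- by move=> t v r; inversion r.
- by move=> t v r; inversion r.
- by move=> t v r; inversion r.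
- by move=> t v r; inversion r.
- move=> p q t u v _ IHp _ IHq w r; inversion r; subst.
  by congr Node; [apply: IHp|apply: IHq].
- move=> p q t u v _ IHq _ IHp w r; inversion r; subst; apply: IHp.
  by rewrite (IHq u0).
- move=> c p q t u v v' _ IHc _ IHp w r; inversion r; subst; first exact: IHp.
  by have := IHc Leaf; move/(_ ltac:(assumption)).
- move=> c p q t v' _ IHc _ IHq w r; inversion r; subst; last exact: IHq.
  by have := IHc (Node u v); move/(_ ltac:(assumption)).
- by move=> p t t0 w r; inversion r.
- move=> p t u v t0 _ IHp _ IHw w r; inversion r; subst => //.
  by apply: IHw; rewrite (IHp u0).
- move=> t b Ob v r; inversion r as [| | | | | | | | | |t' b' Ob']; subst.
  by move: Ob'; rewrite Ob => -[->].
Qed.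

(* An instance may have several codes, or none. *)
Record problem := Problem {
  instance : Type;
  encodes : tree -> instance -> Prop;
  positive : instance -> Prop }.

Definition decides (O : oracle) (p : prog) (X : problem) :=
  forall t (x : instance X), encodes t x ->
    exists2 b : bool, run O p t (tree_of_bool b) & b <-> positive x.

(* Nothing is required of an oracle on trees that encode no instance. *)
Definition decision_oracle (O : oracle) (Y : problem) :=
  forall t (y : instance Y), encodes t y ->
    exists2 b : bool, O t = Some b & b <-> positive y.

Definition reducible (X Y : problem) :=
  exists p : prog, forall O, decision_oracle O Y -> decides O p X.

(* [num t = Some x] when [t] is a code of [x]; a number may have several codes.
   As -1 has a code, the numbers having a code form a subfield of [R] on which
   subtraction is algorithmic too. *)
Record exact_arithmetic (R : realType) (num : tree -> option R) : Prop := {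
  exact_m1 : exists t, num t = Some (-1);
  exact_add : exists p, forall t u x y, num t = Some x -> num u = Some y ->
    exists2 v, run no_oracle p (Node t u) v & num v = Some (x + y);
  exact_mul : exists p, forall t u x y, num t = Some x -> num u = Some y ->
    exists2 v, run no_oracle p (Node t u) v & num v = Some (x * y);
  exact_div : exists p, forall t u x y, num t = Some x -> num u = Some y ->
    y != 0 ->
    exists2 v, run no_oracle p (Node t u) v & num v = Some (x / y);
  exact_eq : exists p, forall t u x y, num t = Some x -> num u = Some y ->
    run no_oracle p (Node t u) (tree_of_bool (x == y)) }.

Inductive code_seq (T : Type) (code : tree -> T -> Prop) :
    tree -> seq T -> Prop :=
| code_nil : code_seq code Leaf [::]
| code_cons t u x s :
    code t x -> code_seq code u s -> code_seq code (Node t u) (x :: s).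

Definition code_num (R : realType) (num : tree -> option R) t x :=
  num t = Some x.

(* A matrix is encoded by the list of its rows. *)
Definition code_mx (R : realType) (num : tree -> option R) p q t
    (M : 'M[R]_(p, q)) :=
  code_seq (code_seq (code_num num)) t
    [seq [seq M i j | j <- enum 'I_q] | i <- enum 'I_p].

(* As [m.+1 > 0], the code determines the dimension [n]. *)
Definition code_family (R : realType) (num : tree -> option R) m n t
    (A : 'I_m.+1 -> 'M[R]_n) :=
  code_seq (@code_mx R num n n) t [seq A a | a <- enum 'I_m.+1].

(* [R] is a phantom parameter: it is where the metric takes its values. *)
Definition oword (R : realType) (S : finType) : Type := nat -> S.

Definition pref (R : realType) (S : finType) (w : oword R S) (k : nat) :
  seq S := mkseq w k.

Section OmegaWordMetric.
Variables (R : realType) (S : finType).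
Implicit Types w : oword R S.

Lemma oword_neq w w' : w <> w' -> exists k, w k != w' k.
Proof.
move=> neq; apply: contrapT => /forallNP eqw; apply: neq.
by apply/funext => k; apply/eqP/negPn/negP; exact: eqw.
Qed.

(* The least index at which the words differ. *)
Definition lcp_length w w' (neq : w <> w') : nat := ex_minn (oword_neq neq).

Definition dC w w' : R :=
  match pselect (w = w') with
  | left _ => 0
  | right neq => 2 ^- lcp_length neq
  end.

Lemma dCxx w : dC w w = 0.
Proof. by rewrite /dC; case: pselect. Qed.

Lemma dC_positivity w w' : dC w w' = 0 -> w = w'.
Proof.
rewrite /dC; case: pselect => // neq /eqP.
by rewrite invr_eq0 expf_eq0 pnatr_eq0 andbF.
Qed.

Lemma dC_lt_pref w w' k : (dC w w' < 2 ^- k) <-> pref w k.+1 = pref w' k.+1.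
Proof.
have prefE : pref w k.+1 = pref w' k.+1 <->
    forall i, (i <= k)%N -> w i = w' i.
  split=> [eqp i ik|eqw].
    have := congr1 (fun s => nth (w 0%N) s i) eqp.
    by rewrite !nth_mkseq.
  apply/eq_in_map => i; rewrite mem_iota add0n ltnS => /andP[_].
  exact: eqw.
rewrite prefE /dC; case: pselect => [->|neq].
  by split=> // _; rewrite invr_gt0 exprn_gt0.
rewrite ltf_pV2 ?posrE ?exprn_gt0// ltr_eXn2l ?ltr1n// /lcp_length.
case: ex_minnP => l neql minl; split => [kl i ik|eqw].
  apply/eqP/negPn/negP => /minl; apply/negP; rewrite -ltnNge.
  exact: leq_ltn_trans kl.
by rewrite ltnNge; apply/negP => /eqw /eqP; exact/negP.
Qed.

Lemma dC_sym w w' : dC w w' = dC w' w.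
Proof.
rewrite /dC; case: pselect => [eqw|neq]; case: pselect => [eqw'|neq'] //;
  [by case: neq'|by case: neq|].
congr (_ ^- _); rewrite /lcp_length.
case: ex_minnP => k nk mink; case: ex_minnP => l nl minl.
by apply/eqP; rewrite eqn_leq mink ?minl // eq_sym.
Qed.

Lemma dC_ge0 w w' : 0 <= dC w w'.
Proof. by rewrite /dC; case: pselect => // neq; rewrite invr_ge0 exprn_ge0. Qed.

Lemma dC_triangle w' w w'' : dC w w'' <= dC w w' + dC w' w''.
Proof.
have [->|neq] := pselect (w = w''); first by rewrite dCxx addr_ge0 ?dC_ge0.
have dE : dC w w'' = 2 ^- lcp_length neq.
  by rewrite /dC; case: pselect => // neq'; rewrite (Prop_irrelevance neq neq').
rewrite dE; set k := lcp_length neq.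
have [kd|dk] := leP (2 ^- k) (dC w w'); first by rewrite ler_wpDr ?dC_ge0.
have [kd'|dk'] := leP (2 ^- k) (dC w' w''); first by rewrite ler_wpDl ?dC_ge0.
move/dC_lt_pref: dk => e1; move/dC_lt_pref: dk' => e2.
have /dC_lt_pref : pref w k.+1 = pref w'' k.+1 by rewrite e1.
by rewrite dE ltxx.
Qed.

HB.instance Definition _ := Choice.copy (oword R S) (nat -> S).
HB.instance Definition _ := isMetric.Build R (oword R S)
  dCxx dC_positivity dC_sym dC_triangle.

End OmegaWordMetric.

Section MatrixProducts.
Variables (R : realType) (S : finType) (n : nat) (A : S -> 'M[R]_n).

Definition word_mx (v : seq S) : 'M[R]_n := \prod_(a <- v) A a.

Definition prefix_products (w : oword R S) : nat -> 'M[R]_n :=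
  fun k => word_mx (pref w k).

Definition continuous_RCP :=
  (forall w, cvgn (prefix_products w)) /\
  continuous (fun w : oword R S => limn (prefix_products w) : 'M[R]_n).

Definition stable :=
  forall w, prefix_products w @ \oo --> (0 : 'M[R]_n).

End MatrixProducts.

Record wfa (R : realType) (S : finType) := WFA {
  nstates : nat;
  initial : 'rV[R]_nstates;
  final : 'cV[R]_nstates;
  trans : S -> 'M[R]_nstates }.

Definition average_preserving (R : realType) (S : finType) (A : wfa R S) :=
  \sum_(a : S) trans A a *m final A = #|S|%:R *: final A.

Definition prefix_weights (R : realType) (S : finType) (A : wfa R S)
    (w : oword R S) : nat -> R :=
  fun k => (initial A *m word_mx (trans A) (pref w k) *m final A) 0 0.

Definition omega_function_continuous (R : realType) (S : finType)
    (A : wfa R S) :=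
  (forall w, cvgn (prefix_weights A w)) /\
  continuous (fun w : oword R S => limn (prefix_weights A w) : R).

Record mx_family (R : realType) := MxFamily {
  mf_letters : nat;
  mf_dim : nat;
  mf_mx : 'I_mf_letters.+1 -> 'M[R]_mf_dim }.

Record ap_wfa (R : realType) := ApWFA {
  ap_letters : nat;
  ap_automaton : wfa R 'I_ap_letters.+1;
  ap_average_preserving : average_preserving ap_automaton }.

Definition code_mx_family (R : realType) (num : tree -> option R) t
    (A : mx_family R) := code_family num t (@mf_mx R A).

Definition code_ap_wfa (R : realType) (num : tree -> option R) t
    (A : ap_wfa R) :=
  let B := ap_automaton A in
  exists ti tf ta,
    [/\ t = Node ti (Node tf ta), code_mx num ti (initial B),
        code_mx num tf (final B) & code_family num ta (trans B)].

Definition MatrixProductStability (R : realType) (num : tree -> option R) :=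
  Problem (code_mx_family num) (fun A => stable (@mf_mx R A)).

Definition MatrixProductContinuity (R : realType) (num : tree -> option R) :=
  Problem (code_mx_family num) (fun A => continuous_RCP (@mf_mx R A)).

Definition ApWFAContinuity (R : realType) (num : tree -> option R) :=
  Problem (code_ap_wfa num)
    (fun A => omega_function_continuous (ap_automaton A)).

(* Main.v *)
(* Let [g v = I A_v F].  Writing [D u = A_u F - F], one has
   [g (v ++ u) - g v = I A_v (D u)], so everything depends on the products [A_v]
   acting on the smallest invariant subspace [V] that contains all [A_a F - F],
   modulo the vectors killed by all the rows [I A_u].  Call [C] the matrices of
   this action.

   If [C] is stable, Koenig's lemma gives a length [N] such that every long word
   has a nonempty prefix of length at most [N] whose product has norm at most
   1/2.  Hence the products [C_v] tend to 0 uniformly, [D] is bounded in the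
   quotient (it is a cocycle), [g] is uniformly Cauchy along prefixes, and the
   limit is continuous.

   Conversely, if the automaton is average preserving, every word [v] extends to
   an infinite word along which [g] does not decrease, and to one along which it
   does not increase; so [g v] lies between two values of the limit function on
   the cylinder of [v].  Continuity then makes [g (v ++ u)] and [g v] close for
   long prefixes [v] of a fixed word, and the entries of [C] tend to 0.  For
   matrix products take [I = F = 1]: approximating [w] by words
   [pref w k ++ b b b ...] and using continuity, the limits satisfy
   [A_w A_b = A_w], which is what is needed.

   To compute [C] without choosing bases, let [Q] and [P] be the orthogonal
   projections onto the span of the rows [I A_u] and onto the image of [V] under
   [Q]; then [C_a = Q A_a P].  Both come from Gram-Schmidt without normalization,
   which uses only the field operations and an equality test. *)

Require Import Defs.
From mathcomp Require Import all_boot all_order all_algebra.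
From mathcomp Require Import all_classical all_reals all_analysis.
From mathcomp Require Import lra.

Set Implicit Arguments.
Unset Strict Implicit.
Unset Printing Implicit Defensive.

Import Order.TTheory GRing.Theory Num.Theory numFieldNormedType.Exports.

Local Open Scope classical_set_scope.
Local Open Scope ring_scope.

(** * Computable functions on encoded data *)

Lemma run_no_oracle O p t u : run no_oracle p t u -> run O p t u.
Proof. by elim=> {p t u}; econstructor; eauto. Qed.

Fixpoint const_prog t :=
  if t is Node u v then PNode (const_prog u) (const_prog v) else PLeaf.

Lemma run_const O t u : run O (const_prog t) u t.
Proof. by elim: t => [|t1 h1 t2 h2]; constructor. Qed.

Class coding (T : Type) := code : tree -> T -> Prop.

Instance bool_coding : coding bool := fun t b => t = tree_of_bool b.

Instance prod_coding T U (cT : coding T) (cU : coding U) : coding (T * U) :=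
  fun t x => exists t1 t2, [/\ t = Node t1 t2, code t1 x.1 & code t2 x.2].

Instance seq_coding T (cT : coding T) : coding (seq T) := code_seq code.

(* One program for all oracles, even those that never answer: queries cannot
   help. *)
Definition computable E T (cE : coding E) (cT : coding T) (f : E -> T) :=
  exists p, forall O t x, code t x -> exists2 u, run O p t u & code u (f x).
Arguments computable {E T cE cT} f.

Lemma computable_id E (cE : coding E) : computable (fun x : E => x).
Proof. by exists PId => O t x tx; exists t => //; constructor. Qed.

Lemma computable_comp E T U (cE : coding E) (cT : coding T) (cU : coding U)
    (g : T -> U) (f : E -> T) :
  computable g -> computable f -> computable (fun x => g (f x)).
Proof.
move=> [q hq] [p hp]; exists (PComp q p) => O t x tx.
have [u pu ux] := hp O t x tx; have [v qv vx] := hq O u _ ux.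
by exists v => //; apply: run_comp pu qv.
Qed.

Lemma computable_const E T (cE : coding E) (cT : coding T) (c : T) :
  (exists t, code t c) -> computable (fun _ : E => c).
Proof.
by move=> [t tc]; exists (const_prog t) => O u x _; exists t => //; exact: run_const.
Qed.

Section Combinators.
Context {E T U : Type} {cE : coding E} {cT : coding T} {cU : coding U}.

Lemma computable_pair (f : E -> T) (g : E -> U) :
  computable f -> computable g -> computable (fun x => (f x, g x)).
Proof.
move=> [p hp] [q hq]; exists (PNode p q) => O t x tx.
have [u pu ux] := hp O t x tx; have [v qv vx] := hq O t x tx.
by exists (Node u v); [constructor|exists u, v].
Qed.

Lemma computable_fst (f : E -> T * U) :
  computable f -> computable (fun x => (f x).1).
Proof.
apply: computable_comp; exists PLeft => O _ [x y] [t [u [-> tx _]]].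
by exists t => //; constructor.
Qed.

Lemma computable_snd (f : E -> T * U) :
  computable f -> computable (fun x => (f x).2).
Proof.
apply: computable_comp; exists PRight => O _ [x y] [t [u [-> _ uy]]].
by exists u => //; constructor.
Qed.

Lemma computable_if (c : E -> bool) (f g : E -> T) :
  computable c -> computable f -> computable g ->
  computable (fun x => if c x then f x else g x).
Proof.
move=> [r hr] [p hp] [q hq]; exists (PIf r p q) => O t x tx.
have [b rb bx] := hr O t x tx; rewrite bx {b bx} in rb.
case: (c x) rb => rb.
  by have [u pu ux] := hp O t x tx; exists u => //; apply: run_if_true rb pu.
by have [u qu ux] := hq O t x tx; exists u => //; apply: run_if_false rb qu.
Qed.

Lemma computable_nil : computable (fun _ : E => [::] : seq T).
Proof. by apply: computable_const; exists Leaf; constructor. Qed.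

Lemma computable_cons (f : E -> T) (g : E -> seq T) :
  computable f -> computable g -> computable (fun x => f x :: g x).
Proof.
move=> [p hp] [q hq]; exists (PNode p q) => O t x tx.
have [u pu ux] := hp O t x tx; have [v qv vx] := hq O t x tx.
by exists (Node u v); constructor.
Qed.

(** The code of a list is its own emptiness test: [Leaf] codes the empty list, and a nonempty list
    is coded by a [Node]. *)
Lemma computable_seq_case (s : E -> seq T) (f : E -> U) (g : E * T * seq T -> U) :
  computable s -> computable f -> computable g ->
  computable (fun x => if s x is y :: r then g (x, y, r) else f x).
Proof.
move=> [r hr] [p hp] [q hq].
exists (PIf r (PComp q (PNode (PNode PId (PComp PLeft r)) (PComp PRight r))) p).
move=> O t x tx; have [u ru us] := hr O t x tx.
inversion us as [e1 e2|t1 t2 y l ty tl e1 e2].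
  have [v pv vx] := hp O t x tx; exists v => //; apply: run_if_false pv.
  by rewrite e1.
have [|v qv vx] := hq O (Node (Node t t1) t2) (x, y, l).
  by exists (Node t t1), t2; split => //; exists t, t1.
exists v => //; apply: (@run_if_true _ _ _ _ _ t1 t2); first by rewrite e1.
apply: run_comp qv; rewrite -e1 in ru; constructor; last first.
  by apply: run_comp ru _; exact: run_right.
by constructor; [constructor|apply: run_comp ru _; exact: run_left].
Qed.

(* The state of the loop is [Node s (Node acc env)], which is false in the test
   exactly when the list [s] is empty. *)
Lemma computable_foldl (step : T -> U -> E -> T) (s : E -> seq U) (a : E -> T) :
  computable s -> computable a ->
  computable (fun x : T * U * E => step x.1.1 x.1.2 x.2) ->
  computable (fun x => foldl (fun b y => step b y x) (a x) (s x)).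
Proof.
move=> [r hr] [p hp] [q hq].
pose arg := PNode (PNode (PComp PLeft PRight) (PComp PLeft PLeft))
                  (PComp PRight PRight).
pose body := PNode (PComp PRight PLeft)
               (PNode (PComp q arg) (PComp PRight PRight)).
exists (PComp (PComp PLeft PRight)
         (PComp (PWhile body) (PNode r (PNode p PId)))) => O t x tx.
have [v pv vx] := hp O t x tx; have [u ru us] := hr O t x tx.
have loop : exists2 w, code w (foldl (fun b y => step b y x) (a x) (s x)) &
    run O (PWhile body) (Node u (Node v t)) (Node Leaf (Node w t)).
  move: (s x) us (a x) v vx {pv ru} => l.
  elim=> {u l} [b v vb|t1 t2 y l t1y t2l IHl b v vb].
    by exists v => //; apply: run_while_stop.
  have [|v' qv' v'b] := hq O (Node (Node v t1) t) (b, y, x).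
    by exists (Node v t1), t; split => //; exists v, t1.
  have [w wb runw] := IHl _ _ v'b; exists w => //.
  apply: run_while_step runw => //.
  have L O' t' u' : run O' PLeft (Node t' u') t' by exact: run_left.
  have Rt O' t' u' : run O' PRight (Node t' u') u' by exact: run_right.
  constructor; first by apply: run_comp (L _ _ _) (Rt _ _ _).
  constructor; last by apply: run_comp (Rt _ _ _) (Rt _ _ _).
  apply: run_comp qv'; constructor; last by apply: run_comp (Rt _ _ _) (Rt _ _ _).
  by constructor; [apply: run_comp (Rt _ _ _) (L _ _ _)
                  |apply: run_comp (L _ _ _) (L _ _ _)].
have [w wx runw] := loop; exists w => //.
apply: (@run_comp _ _ _ _ (Node Leaf (Node w t))).
  apply: run_comp runw; constructor; first exact: ru.
  by constructor => //; constructor.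
apply: run_comp; first exact: run_right.
exact: run_left.
Qed.

End Combinators.

Ltac computable_var :=
  match goal with
  | |- computable (fun x => x) => apply computable_id
  | |- computable fst => apply computable_fst, computable_id
  | |- computable snd => apply computable_snd, computable_id
  | |- computable (fun x => fst _) => apply computable_fst; computable_var
  | |- computable (fun x => snd _) => apply computable_snd; computable_var
  end.

Lemma computable_rev E T (cE : coding E) (cT : coding T) (s : E -> seq T) :
  computable s -> computable (fun x => rev (s x)).
Proof.
(* The redundant abstraction over [E] gives the body the shape [step b y x] of
   [computable_foldl]. *)
move=> hs; rewrite (_ : (fun x => _) =
    fun x => foldl (fun b y => (fun b y (_ : E) => y :: b) b y x) [::] (s x)).
  apply: computable_foldl hs _ _; first exact: computable_nil.
  by apply: computable_cons; computable_var.
apply/funext => x; rewrite -[in RHS](revK (s x)) foldl_rev.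
by elim: (rev (s x)) => //= y l {1}->.
Qed.

Lemma computable_foldr E T U (cE : coding E) (cT : coding T) (cU : coding U)
    (step : U -> T -> E -> T) (s : E -> seq U) (a : E -> T) :
  computable s -> computable a ->
  computable (fun x : U * T * E => step x.1.1 x.1.2 x.2) ->
  computable (fun x => foldr (fun y b => step y b x) (a x) (s x)).
Proof.
move=> /computable_rev hs ha hstep; rewrite (_ : (fun x => _) = fun x =>
    foldl (fun b y => (fun b y e => step y b e) b y x) (a x) (rev (s x))).
  apply: computable_foldl => //.
  apply: (computable_comp (f := fun z : T * U * E => (z.1.2, z.1.1, z.2))) hstep _.
  by do ?apply: computable_pair; computable_var.
by apply/funext => x; rewrite foldl_rev.
Qed.

Lemma computable_map E T U (cE : coding E) (cT : coding T) (cU : coding U)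
    (f : U -> E -> T) (s : E -> seq U) :
  computable s -> computable (fun x : U * E => f x.1 x.2) ->
  computable (fun x => [seq f y x | y <- s x]).
Proof.
move=> hs hf; rewrite (_ : (fun x => _) = fun x =>
    foldr (fun y b => (fun y b x => f y x :: b) y b x) [::] (s x)).
  apply: computable_foldr => //; first exact: computable_nil.
  apply: computable_cons; last by computable_var.
  apply: (computable_comp (f := fun z : U * seq T * E => (z.1.1, z.2))) hf _.
  by apply: computable_pair; computable_var.
by apply/funext => x; elim: (s x) => //= y l ->.
Qed.

Lemma computable_cat E T (cE : coding E) (cT : coding T) (s t : E -> seq T) :
  computable s -> computable t -> computable (fun x => s x ++ t x).
Proof.
move=> hs ht; rewrite (_ : (fun x => _) = fun x =>
    foldr (fun y b => (fun y b (_ : E) => y :: b) y b x) (t x) (s x)).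
  apply: computable_foldr => //; apply: computable_cons; by computable_var.
by apply/funext => x; elim: (s x) => //= y l ->.
Qed.

Lemma computable_zip E T U (cE : coding E) (cT : coding T) (cU : coding U)
    (s : E -> seq T) (t : E -> seq U) :
  computable s -> computable t -> computable (fun x => zip (s x) (t x)).
Proof.
(* The state of the fold over [s] holds the pairs made so far, in reverse order, and the unread rest
   of [t]. *)
pose step (st : seq (T * U) * seq U) (y : T) (_ : E) :=
  if st.2 is z :: r then ((y, z) :: st.1, r) else st.
move=> hs ht; rewrite (_ : (fun x => _) = fun x =>
    rev (foldl (fun b y => step b y x) ([::], t x) (s x)).1).
  apply: computable_rev; apply: computable_fst.
  apply: computable_foldl hs _ _.
    by apply: computable_pair => //; exact: computable_nil.
  apply: (computable_seq_case (s := fun e => e.1.1.2) (f := fun e => e.1.1)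
    (g := fun e => ((e.1.1.1.2, e.1.2) :: e.1.1.1.1.1, e.2)));
    do ?[apply: computable_pair|apply: computable_cons];
    by computable_var.
apply/funext => x.
suff zipE l r a : rev a ++ zip l r =
    rev (foldl (fun b y => step b y x) (a, r) l).1.
  by rewrite -zipE.
elim: l r a => [|y l IHl] [|z r] a; rewrite /= ?cats0 //; last first.
  by rewrite -IHl rev_cons cat_rcons.
by elim: l {IHl} => //= z l IHl; rewrite cats0.
Qed.

Lemma computable_flatten E T (cE : coding E) (cT : coding T)
    (s : E -> seq (seq T)) :
  computable s -> computable (fun x => flatten (s x)).
Proof.
move=> hs; rewrite (_ : (fun x => _) = fun x =>
    foldr (fun y b => (fun y b (_ : E) => y ++ b) y b x) [::] (s x)) //.
apply: computable_foldr => //; first exact: computable_nil.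
by apply: computable_cat; computable_var.
Qed.

(** * The algorithms, on lists of numbers *)

(* Vectors are lists and matrices are lists of rows, as in the codes. *)
Section ListAlgorithms.
Variable F : fieldType.
Implicit Types (x y z : seq F) (A : seq (seq F)).

Definition dotl x y := foldr (fun p b => p.1 * p.2 + b) 0 (zip x y).
Definition scalel c x := [seq c * a | a <- x].
Definition addl x y := [seq p.1 + p.2 | p <- zip x y].
Definition subl x y := addl x (scalel (-1) y).
Definition mulvl A y := [seq dotl r y | r <- A].

(** The fold starts with one empty row per row of [A], which is right for square matrices. *)
Definition trl A := foldr (fun r B => [seq p.1 :: p.2 | p <- zip r B])
  [seq [::] | r <- A] A.

(** [A] only supplies its number of rows. The state pairs a zero row with an identity matrix of the
    same size. *)
Definition idl A := (foldr (fun _ zB =>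
  (0 :: zB.1, ((1 : F) :: zB.1) :: [seq 0 :: r | r <- zB.2])) ([::], [::]) A).2.

(* Orthogonal projection onto the span of [zs], whose elements must be nonzero
   and pairwise orthogonal. *)
Definition projl zs y :=
  foldr (fun z b => addl (scalel (dotl y z / dotl z z) z) b) (scalel 0 y) zs.

(** Over an ordered field a residual of square length 0 is zero, so a dropped vector already lies in
    the span; the kept ones are nonzero, as [projl] requires. *)
Definition gram_schmidtl ys := foldr (fun y zs =>
  if dotl (subl y (projl zs y)) (subl y (projl zs y)) == 0 then zs
  else subl y (projl zs y) :: zs) [::] ys.

(* [A] is only a counter: there is one iteration per row. *)
Definition closurel As ys A := foldr (fun _ vs =>
  vs ++ flatten [seq [seq mulvl B y | y <- vs] | B <- As]) ys A.

(** [mulvl] makes matrices act on columns, so the rows [u A_v] are generated with the transposes.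
    The first matrix of the family is the counter. *)
Definition rowspanl As us :=
  gram_schmidtl (closurel [seq trl A | A <- As] us (head [::] As)).

Definition leftl zs A := trl [seq projl zs r | r <- trl A].

Definition rightl zs A := [seq projl zs r | r <- A].

Definition defectl As fs :=
  flatten [seq [seq subl (mulvl A f) f | f <- fs] | A <- As].

Definition colspanl As fs :=
  gram_schmidtl (closurel As (defectl As fs) (head [::] As)).

Definition reducel_right As fs := [seq rightl (colspanl As fs) A | A <- As].

Definition reducel_left As us fs :=
  ([seq leftl (rowspanl As us) A | A <- As],
   [seq projl (rowspanl As us) f | f <- fs]).

(** The column span is computed from the left-reduced data, hence in the quotient by the vectors
    that all the rows kill. *)
Definition reducel As us fs :=
  reducel_right (reducel_left As us fs).1 (reducel_left As us fs).2.

End ListAlgorithms.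

(** * Computability of the list algorithms *)

Section ComputableAlgorithms.
Variables (R : realType) (num : tree -> option R).
Hypothesis arith : exact_arithmetic num.

Local Instance num_coding : coding R := code_num num.

Lemma computable_comp2 E T U V (cE : coding E) (cT : coding T) (cU : coding U)
    (cV : coding V) (h : T -> U -> V) (f : E -> T) (g : E -> U) :
  computable (fun p : T * U => h p.1 p.2) -> computable f -> computable g ->
  computable (fun x => h (f x) (g x)).
Proof.
move=> hh hf hg; apply: (computable_comp (f := fun x => (f x, g x))) hh _.
exact: computable_pair.
Qed.

Lemma computable_comp3 E T U V W (cE : coding E) (cT : coding T) (cU : coding U)
    (cV : coding V) (cW : coding W) (h : T -> U -> V -> W)
    (f : E -> T) (g : E -> U) (k : E -> V) :
  computable (fun p : T * U * V => h p.1.1 p.1.2 p.2) ->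
  computable f -> computable g -> computable k ->
  computable (fun x => h (f x) (g x) (k x)).
Proof.
move=> hh hf hg hk; apply: (computable_comp (f := fun x => (f x, g x, k x))) hh _.
by do !apply: computable_pair.
Qed.

Lemma computable_add E (cE : coding E) (f g : E -> R) :
  computable f -> computable g -> computable (fun x => f x + g x).
Proof.
move=> hf hg.
apply: (computable_comp (f := fun x => (f x, g x)) (g := fun p => p.1 + p.2));
  last exact: computable_pair.
have [p hp] := exact_add arith; exists p => O _ [x y] [t [u [-> tx uy]]].
by have [v pv vxy] := hp _ _ _ _ tx uy; exists v => //; exact: run_no_oracle.
Qed.

Lemma computable_mul E (cE : coding E) (f g : E -> R) :
  computable f -> computable g -> computable (fun x => f x * g x).
Proof.
move=> hf hg.
apply: (computable_comp (f := fun x => (f x, g x)) (g := fun p => p.1 * p.2));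
  last exact: computable_pair.
have [p hp] := exact_mul arith; exists p => O _ [x y] [t [u [-> tx uy]]].
by have [v pv vxy] := hp _ _ _ _ tx uy; exists v => //; exact: run_no_oracle.
Qed.

Lemma computable_eq E (cE : coding E) (f g : E -> R) :
  computable f -> computable g -> computable (fun x => f x == g x).
Proof.
move=> hf hg.
apply: (computable_comp (f := fun x => (f x, g x)) (g := fun p => p.1 == p.2));
  last exact: computable_pair.
have [p hp] := exact_eq arith; exists p => O _ [x y] [t [u [-> tx uy]]].
by exists (tree_of_bool (x == y)) => //; apply: run_no_oracle; exact: hp.
Qed.

Lemma computable_m1 E (cE : coding E) : computable (fun _ : E => -1 : R).
Proof. by apply: computable_const; exact: exact_m1 arith. Qed.

Lemma computable_1 E (cE : coding E) : computable (fun _ : E => 1 : R).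
Proof.
(* [exact_arithmetic] provides a code of -1 only; 1, and then 0, are computed from it. *)
rewrite (_ : (fun _ => _) = fun _ => (-1) * (-1)); last by rewrite mulrNN mulr1.
by apply: computable_mul; exact: computable_m1.
Qed.

Lemma computable_0 E (cE : coding E) : computable (fun _ : E => 0 : R).
Proof.
rewrite (_ : (fun _ => _) = fun _ => 1 + (-1)); last by rewrite subrr.
by apply: computable_add; [exact: computable_1|exact: computable_m1].
Qed.

(* In MathComp [x / 0 = 0], whereas [exact_div] is silent on that case. *)
Lemma computable_div E (cE : coding E) (f g : E -> R) :
  computable f -> computable g -> computable (fun x => f x / g x).
Proof.
move=> hf hg.
apply: (computable_comp (f := fun x => (f x, g x)) (g := fun p => p.1 / p.2));
  last exact: computable_pair.
have [q hq] := computable_eq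
  (computable_snd (computable_id (prod_coding num_coding num_coding)))
  (computable_0 _).
have [r hr] := computable_0 (prod_coding num_coding num_coding).
have [p hp] := exact_div arith.
exists (PIf q r p) => O t [x y] txy; have [b qb b0] := hq O t _ txy.
rewrite b0 {b b0} in qb; case: eqP qb => /= [-> | /eqP y0] qb.
  have [u ru u0] := hr O t _ txy; exists u; first exact: run_if_true qb ru.
  by rewrite invr0 mulr0.
have [t1 [t2 [tE t1x t2y]]] := txy; rewrite tE in qb *.
have [u pu uxy] := hp _ _ _ _ t1x t2y y0; exists u => //.
by apply: run_if_false qb _; exact: run_no_oracle.
Qed.

Lemma computable_head E T (cE : coding E) (cT : coding T)
    (s : E -> seq (seq T)) :
  computable s -> computable (fun x => head [::] (s x)).
Proof.
move=> hs.
apply: (computable_seq_case (f := fun=> [::]) (g := fun p => p.1.2)) hs _ _.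
  exact: computable_nil.
by computable_var.
Qed.

(** Each case peels the head symbol of the body. A named algorithm is handled when its computability
    is a hypothesis; the last case eta-expands. *)
Ltac computable_step :=
  match goal with
  | |- computable (fun x => foldr _ _ _) => apply: computable_foldr
  | |- computable (fun x => map _ _) => apply: computable_map
  | |- computable (fun x => zip _ _) => apply: computable_zip
  | |- computable (fun x => _ :: _) => apply: computable_cons
  | |- computable (fun x => _ ++ _) => apply: computable_cat
  | |- computable (fun x => flatten _) => apply: computable_flatten
  | |- computable (fun x => (_, _)) => apply: computable_pair
  | |- computable (fun x => [::]) => exact: computable_nil
  | |- computable (fun x => if _ then _ else _) => apply: computable_if
  | |- computable (fun x => _ == _) => apply: computable_eq
  | |- computable (fun x => _ + _) => apply: computable_add
  | |- computable (fun x => _ / _) => apply: computable_div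
  | |- computable (fun x => _ * _) => apply: computable_mul
  | |- computable (fun x => 0) => exact: computable_0
  | |- computable (fun x => 1) => exact: computable_1
  | |- computable (fun x => -1) => exact: computable_m1
  | |- computable (fun x => head [::] _) => apply: computable_head
  | H : computable (fun p => ?h p.1 p.2) |- computable (fun x => ?h _ _) =>
      apply: (computable_comp2 H)
  | H : computable (fun p => ?h p.1.1 p.1.2 p.2) |- computable (fun x => ?h _ _ _) =>
      apply: (computable_comp3 H)
  | H : computable ?h |- computable (fun x => ?h _) => apply: (computable_comp H)
  | |- computable (fun x => _) => computable_var
  | |- @computable ?E ?T ?cE ?cT ?f => change (@computable E T cE cT (fun x => f x))
  end.
Ltac computable := repeat (computable_step; cbv beta).

Local Notation vec := (seq R).
Local Notation mx := (seq (seq R)).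

Lemma computable_dotl : computable (fun p : vec * vec => dotl p.1 p.2).
Proof. by rewrite /dotl; computable. Qed.

Lemma computable_scalel : computable (fun p : R * vec => scalel p.1 p.2).
Proof. by rewrite /scalel; computable. Qed.

Lemma computable_addl : computable (fun p : vec * vec => addl p.1 p.2).
Proof. by rewrite /addl; computable. Qed.

Lemma computable_subl : computable (fun p : vec * vec => subl p.1 p.2).
Proof.
by have [? ?] := (computable_scalel, computable_addl); rewrite /subl; computable.
Qed.

Lemma computable_mulvl : computable (fun p : mx * vec => mulvl p.1 p.2).
Proof. by have := computable_dotl; rewrite /mulvl => ?; computable. Qed.

Lemma computable_trl : computable (fun A : mx => trl A).
Proof. by rewrite /trl; computable. Qed.

Lemma computable_idl : computable (fun A : mx => idl A).
Proof. by rewrite /idl; apply: computable_snd; computable. Qed.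

Lemma computable_projl : computable (fun p : mx * vec => projl p.1 p.2).
Proof.
have [[? ?] ?] := (computable_scalel, computable_addl, computable_dotl).
by rewrite /projl; computable.
Qed.

Lemma computable_gram_schmidtl : computable (fun ys : mx => gram_schmidtl ys).
Proof.
have [[? ?] ?] := (computable_subl, computable_projl, computable_dotl).
by rewrite /gram_schmidtl; computable.
Qed.

Lemma computable_closurel :
  computable (fun p : seq mx * mx * mx => closurel p.1.1 p.1.2 p.2).
Proof. by have ? := computable_mulvl; rewrite /closurel; computable. Qed.

Lemma computable_rowspanl :
  computable (fun p : seq mx * mx => rowspanl p.1 p.2).
Proof.
have [[? ?] ?] := (computable_gram_schmidtl, computable_closurel, computable_trl).
by rewrite /rowspanl; computable.
Qed.

Lemma computable_leftl : computable (fun p : mx * mx => leftl p.1 p.2).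
Proof.
by have [? ?] := (computable_trl, computable_projl); rewrite /leftl; computable.
Qed.

Lemma computable_rightl : computable (fun p : mx * mx => rightl p.1 p.2).
Proof. by have ? := computable_projl; rewrite /rightl; computable. Qed.

Lemma computable_defectl : computable (fun p : seq mx * mx => defectl p.1 p.2).
Proof.
by have [? ?] := (computable_mulvl, computable_subl); rewrite /defectl; computable.
Qed.

Lemma computable_colspanl : computable (fun p : seq mx * mx => colspanl p.1 p.2).
Proof.
have [[? ?] ?] := (computable_gram_schmidtl, computable_closurel, computable_defectl).
by rewrite /colspanl; computable.
Qed.

Lemma computable_reducel_right :
  computable (fun p : seq mx * mx => reducel_right p.1 p.2).
Proof.
have [? ?] := (computable_colspanl, computable_rightl).
by rewrite /reducel_right; computable.
Qed.

Lemma computable_reducel_left :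
  computable (fun p : seq mx * mx * mx => reducel_left p.1.1 p.1.2 p.2).
Proof.
have [[? ?] ?] := (computable_rowspanl, computable_leftl, computable_projl).
by rewrite /reducel_left; computable.
Qed.

Lemma computable_reducel :
  computable (fun p : seq mx * mx * mx => reducel p.1.1 p.1.2 p.2).
Proof.
have [? ?] := (computable_reducel_right, computable_reducel_left).
rewrite /reducel; computable_step; last by apply: computable_snd; computable.
by apply: computable_fst; computable.
Qed.

End ComputableAlgorithms.

(** * From lists to matrices *)

Section Refinement.
Variables (F : fieldType) (n : nat).
Implicit Types (x y z : 'rV[F]_n) (A : 'M[F]_n) (zs ys : seq 'rV[F]_n).

Definition dotv x y := (x *m y^T) 0 0.

(** Acts on row vectors from the right; an orthogonal projection when the elements of [zs] are
    nonzero and pairwise orthogonal. *)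
Definition orthproj zs := \sum_(z <- zs) (dotv z z)^-1 *: (z^T *m z).

Definition gram_schmidt ys := foldr (fun y zs =>
  if dotv (y - y *m orthproj zs) (y - y *m orthproj zs) == 0 then zs
  else y - y *m orthproj zs :: zs) [::] ys.

Definition closurev (As : seq 'M[F]_n) ys k := iter k (fun vs =>
  vs ++ flatten [seq [seq y *m B^T | y <- vs] | B <- As]) ys.

Definition defectv (As : seq 'M[F]_n) (fs : seq 'rV[F]_n) :=
  flatten [seq [seq f *m A^T - f | f <- fs] | A <- As].

Definition row_proj (As : seq 'M[F]_n) us :=
  orthproj (gram_schmidt (closurev [seq A^T | A <- As] us n)).

Definition col_proj (As : seq 'M[F]_n) fs :=
  orthproj (gram_schmidt (closurev As (defectv As fs) n)).

Definition rowl x := [seq x 0 j | j <- enum 'I_n].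

Definition mxl p q (M : 'M[F]_(p, q)) :=
  [seq [seq M i j | j <- enum 'I_q] | i <- enum 'I_p].

Lemma mxlE p (M : 'M[F]_(p, n)) : mxl M = [seq rowl (row i M) | i <- enum 'I_p].
Proof.
by apply/eq_map => i; apply/eq_map => j; rewrite mxE.
Qed.

Lemma size_mxl p q (M : 'M[F]_(p, q)) : size (mxl M) = p.
Proof. by rewrite size_map size_enum_ord. Qed.

Lemma dotl_rowl x y : dotl (rowl x) (rowl y) = dotv x y.
Proof.
rewrite /dotl zip_map foldr_map -[dotv x y]/((x *m y^T) 0 0) mxE /=.
rewrite -big_enum /=; elim: (enum 'I_n) => [|i s IHs]; first by rewrite big_nil.
by rewrite big_cons /= IHs mxE.
Qed.

Lemma scalel_rowl c x : scalel c (rowl x) = rowl (c *: x).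
Proof. by rewrite /scalel -map_comp; apply/eq_map => i; rewrite /= mxE. Qed.

Lemma addl_rowl x y : addl (rowl x) (rowl y) = rowl (x + y).
Proof. by rewrite /addl zip_map -map_comp; apply/eq_map => i; rewrite /= mxE. Qed.

Lemma subl_rowl x y : subl (rowl x) (rowl y) = rowl (x - y).
Proof. by rewrite /subl scalel_rowl addl_rowl scaleN1r. Qed.

Lemma mulvl_mxl A y : mulvl (mxl A) (rowl y) = rowl (y *m A^T).
Proof.
rewrite /mulvl mxlE -map_comp; apply/eq_map => i; rewrite /= dotl_rowl /dotv !mxE.
by apply: eq_bigr => j _; rewrite !mxE mulrC.
Qed.

Lemma trl_mxl A : trl (mxl A) = mxl A^T.
Proof.
have -> : mxl A^T = [seq [seq A i j | i <- enum 'I_n] | j <- enum 'I_n].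
  by apply/eq_map => j; apply/eq_map => i; rewrite mxE.
rewrite /trl.
have -> : [seq [::] | r <- mxl A] = [seq [::] | j <- enum 'I_n] :> seq (seq F).
  by rewrite -map_comp.
(* Induction on the row indices alone; the column indices remain the full enumeration. *)
rewrite {1}/mxl; elim: {3 4}(enum 'I_n) => //= i s ->.
by rewrite zip_map -map_comp.
Qed.

Lemma idl_mxl A : idl (mxl A) = mxl (1%:M : 'M[F]_n).
Proof.
rewrite /idl; move: (mxl A) (size_mxl A) => s sn.
set f := fun _ => _; suff [_ -> //] : (foldr f ([::], [::]) s).1 = nseq n 0 /\
    (foldr f ([::], [::]) s).2 = mxl (1%:M : 'M[F]_n).
clear A; elim: s n sn => [|a s IHs] [|m] //= => [_|[sm]].
  by split=> //; rewrite /mxl enum_ord0.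
have [-> ->] := IHs m sm; split=> //.
rewrite {2}/mxl enum_ordSl /= mxE eqxx; congr (_ :: _).
  congr (_ :: _); rewrite -map_comp -[in LHS](size_enum_ord m).
  by elim: (enum _) => //= i l ->; rewrite mxE.
rewrite /mxl -[LHS]map_comp -[RHS]map_comp; apply/eq_map => i /=.
rewrite mxE /=; congr (_ :: _).
transitivity [seq (1%:M : 'M[F]_m.+1) (lift ord0 i) (lift ord0 j) | j <- enum 'I_m].
  by apply/eq_map => j; rewrite !mxE.
by rewrite -[RHS]map_comp.
Qed.

Lemma orthproj_cons z zs :
  orthproj (z :: zs) = (dotv z z)^-1 *: (z^T *m z) + orthproj zs.
Proof. by rewrite /orthproj big_cons. Qed.

Lemma projl_rowl zs y :
  projl [seq rowl z | z <- zs] (rowl y) = rowl (y *m orthproj zs).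
Proof.
elim: zs => [|z zs IHzs] /=.
  by rewrite /projl /= scalel_rowl scale0r /orthproj big_nil mulmx0.
rewrite /projl /= -/(projl _ _) IHzs !dotl_rowl scalel_rowl addl_rowl.
rewrite orthproj_cons mulmxDr -scalemxAr mulmxA [y *m z^T]mx11_scalar.
by rewrite mul_scalar_mx scalerA mulrC.
Qed.

Lemma gram_schmidtl_rowl ys :
  gram_schmidtl [seq rowl y | y <- ys] = [seq rowl z | z <- gram_schmidt ys].
Proof.
elim: ys => //= y ys IHys; rewrite /gram_schmidtl /= -/(gram_schmidtl _) IHys.
by rewrite projl_rowl subl_rowl dotl_rowl; case: ifP.
Qed.

Lemma closurel_rowl As ys A :
  closurel [seq mxl B | B <- As] [seq rowl y | y <- ys] (mxl A) =
  [seq rowl y | y <- closurev As ys n].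
Proof.
have -> : closurev As ys n = closurev As ys (size (mxl A)) by rewrite size_mxl.
rewrite /closurel; elim: (mxl A) => //= _ s ->.
rewrite map_cat map_flatten; congr (_ ++ flatten _); rewrite -!map_comp.
apply/eq_map => B /=; rewrite -!map_comp; apply/eq_map => y /=.
exact: mulvl_mxl.
Qed.

(** The exposed first matrix has [n] rows, so the counter makes [closurel] iterate [n] times. *)
Lemma rowspanl_mxl A As us :
  rowspanl [seq mxl B | B <- A :: As] [seq rowl u | u <- us] =
  [seq rowl z | z <- gram_schmidt (closurev [seq B^T | B <- A :: As] us n)].
Proof.
rewrite /rowspanl -gram_schmidtl_rowl -(closurel_rowl _ _ A) -!map_comp /=.
rewrite trl_mxl; congr (gram_schmidtl (closurel (_ :: _) _ _)).
by apply/eq_map => B /=; rewrite trl_mxl.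
Qed.

Lemma leftl_mxl zs A :
  leftl [seq rowl z | z <- zs] (mxl A) = mxl ((orthproj zs)^T *m A).
Proof.
rewrite /leftl trl_mxl -[X in _ = mxl X]trmxK -[RHS]trl_mxl; congr trl.
rewrite !mxlE -map_comp; apply/eq_map => i /=.
by rewrite projl_rowl trmx_mul trmxK row_mul.
Qed.

Lemma rightl_mxl zs A :
  rightl [seq rowl z | z <- zs] (mxl A) = mxl (A *m orthproj zs).
Proof.
rewrite /rightl !mxlE -map_comp; apply/eq_map => i /=.
by rewrite projl_rowl row_mul.
Qed.

Lemma defectl_mxl As fs :
  defectl [seq mxl A | A <- As] [seq rowl f | f <- fs] =
  [seq rowl y | y <- defectv As fs].
Proof.
rewrite /defectl /defectv map_flatten -!map_comp; congr flatten.
apply/eq_map => A /=; rewrite -!map_comp; apply/eq_map => f /=.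
by rewrite mulvl_mxl subl_rowl.
Qed.

Lemma reducel_right_mxl A As fs :
  reducel_right [seq mxl B | B <- A :: As] [seq rowl f | f <- fs] =
  [seq mxl (B *m col_proj (A :: As) fs) | B <- A :: As].
Proof.
rewrite /reducel_right /colspanl -[head _ _]/(mxl A) defectl_mxl.
rewrite (closurel_rowl (A :: As)) gram_schmidtl_rowl -map_comp.
by apply/eq_map => B; exact: rightl_mxl.
Qed.

Lemma reducel_mxl A As us fs :
  let Q := row_proj (A :: As) us in
  let Bs := [seq Q^T *m B | B <- A :: As] in
  let gs := [seq f *m Q | f <- fs] in
  reducel [seq mxl B | B <- A :: As] [seq rowl u | u <- us] [seq rowl f | f <- fs]
  = [seq mxl (B *m col_proj Bs gs) | B <- Bs].
Proof.
move=> Q Bs gs.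
transitivity (reducel_right [seq mxl B | B <- Bs] [seq rowl g | g <- gs]);
  last exact: reducel_right_mxl.
rewrite /reducel /reducel_left rowspanl_mxl /fst /snd /Bs /gs.
congr reducel_right; rewrite -[LHS]map_comp -[RHS]map_comp.
  by apply/eq_map => B; exact: leftl_mxl.
by apply/eq_map => f; exact: projl_rowl.
Qed.

End Refinement.

(** * Orthogonal projections and invariant subspaces *)

Section Projections.
Variables (F : realFieldType) (n : nat).
Implicit Types (x y z : 'rV[F]_n) (zs ys : seq 'rV[F]_n) (As : seq 'M[F]_n).

(** A predicate rather than a matrix, so that conditions such as convergence to 0 along all words
    count as subspaces. *)
Definition subspace (K : 'rV[F]_n -> Prop) :=
  K 0 /\ forall c x y, K x -> K y -> K (c *: x + y).

Lemma subspace_mx p q (M N : 'M[F]_(n, p)) (L : 'M[F]_(p, q)) (L' : 'M[F]_(p, q)) :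
  subspace (fun x => x *m M *m L = x *m N *m L').
Proof.
split=> [|c x y hx hy]; first by rewrite !mul0mx.
by rewrite !mulmxDl -!scalemxAl hx hy.
Qed.

Lemma subspace_submx p (M : 'M[F]_(n, p)) q (V : 'M[F]_(q, p)) :
  subspace (fun x => (x *m M <= V)%MS).
Proof.
split=> [|c x y hx hy]; first by rewrite mul0mx sub0mx.
by rewrite mulmxDl -scalemxAl addmx_sub // scalemx_sub.
Qed.

Lemma dotv_eq0 x : dotv x x = 0 -> x = 0.
Proof.
rewrite /dotv mxE => /eqP; rewrite psumr_eq0 => [/allP x0|i _]; last first.
  by rewrite mxE -expr2 sqr_ge0.
apply/rowP => i; have := x0 i (mem_index_enum _).
by rewrite mxE -expr2 sqrf_eq0 mxE => /eqP.
Qed.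

Lemma orthproj_sym zs : (orthproj zs)^T = orthproj zs.
Proof.
rewrite /orthproj raddf_sum; apply: eq_bigr => z _.
apply/matrixP => i j; rewrite !mxE; congr (_ * _).
by apply: eq_bigr => k _; rewrite !mxE mulrC.
Qed.

Lemma orthproj_ind K zs x : subspace K -> (forall z, z \in zs -> K z) ->
  K (x *m orthproj zs).
Proof.
move=> [K0 Klin]; elim: zs => [|z zs IHzs] Kzs.
  by rewrite /orthproj big_nil mulmx0.
rewrite orthproj_cons mulmxDr -scalemxAr mulmxA [x *m z^T]mx11_scalar.
rewrite mul_scalar_mx scalerA; apply: Klin; first by apply: Kzs; rewrite mem_head.
by apply: IHzs => y yzs; apply: Kzs; rewrite inE yzs orbT.
Qed.

Lemma orthproj_idem zs : (forall z, z \in zs -> z *m orthproj zs = z) ->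
  forall x, x *m orthproj zs *m orthproj zs = x *m orthproj zs.
Proof.
move=> fix_zs x.
have := @orthproj_ind (fun x => x *m orthproj zs *m 1%:M = x *m 1%:M *m 1%:M) zs x.
by rewrite !mulmx1; apply; [exact: subspace_mx|move=> z /fix_zs; rewrite !mulmx1].
Qed.

Lemma gram_schmidt_cons y ys : gram_schmidt (y :: ys) =
  let r := y - y *m orthproj (gram_schmidt ys) in
  if dotv r r == 0 then gram_schmidt ys else r :: gram_schmidt ys.
Proof. by []. Qed.

(** Let [P] be the projection built so far. It is idempotent, so the residual satisfies [r P = 0].
    As [P] is symmetric and fixes each earlier [z], [<z, r> = <z P, r> = <z, r P> = 0]. *)
Lemma gram_schmidt_fix ys z :
  z \in gram_schmidt ys -> z *m orthproj (gram_schmidt ys) = z.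
Proof.
elim: ys z => [|y ys IHys] z //; rewrite gram_schmidt_cons.
set zs := gram_schmidt ys in IHys *; set r := y - _; rewrite /=.
case: eqP => [_|r0]; first exact: IHys.
rewrite inE orthproj_cons mulmxDr -scalemxAr.
have rP : r *m orthproj zs = 0.
  by rewrite mulmxBl orthproj_idem ?subrr.
rewrite mulmxA [z *m r^T]mx11_scalar mul_scalar_mx scalerA -/(dotv z r).
case/orP=> [/eqP ->|zzs]; first by rewrite rP addr0 mulVf ?scale1r //; exact/eqP.
suff -> : dotv z r = 0 by rewrite mulr0 scale0r add0r IHys.
rewrite -{1}(IHys _ zzs) /dotv -mulmxA -[orthproj zs]orthproj_sym -trmx_mul rP.
by rewrite trmx0 mulmx0 mxE.
Qed.

Lemma gram_schmidt_ind K ys : subspace K -> (forall y, y \in ys -> K y) ->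
  forall z, z \in gram_schmidt ys -> K z.
Proof.
move=> sK; elim: ys => [|y ys IHys] Kys //; rewrite gram_schmidt_cons /=.
have {}IHys : forall z, z \in gram_schmidt ys -> K z.
  by apply: IHys => z zys; apply: Kys; rewrite inE zys orbT.
case: ifP => // _ z; rewrite inE => /orP[/eqP ->|]; last exact: IHys.
rewrite addrC -scaleN1r; apply: sK.2; first exact: orthproj_ind.
by apply: Kys; rewrite mem_head.
Qed.

Definition proj_span ys := orthproj (gram_schmidt ys).

Lemma proj_span_ind K ys x : subspace K -> (forall y, y \in ys -> K y) ->
  K (x *m proj_span ys).
Proof. by move=> sK Kys; apply: orthproj_ind => //; exact: gram_schmidt_ind. Qed.

Lemma proj_span_idem ys x :
  x *m proj_span ys *m proj_span ys = x *m proj_span ys.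
Proof. by apply: orthproj_idem => z; exact: gram_schmidt_fix. Qed.

(** Either the residual of [z] vanishes and [z = z P], or [z = r + z P] and the new term of the
    projection restores [r], because [<z, r> = <r, r>]. *)
Lemma proj_span_fix ys y : y \in ys -> y *m proj_span ys = y.
Proof.
rewrite /proj_span; elim: ys => [|z ys IHys] //; rewrite gram_schmidt_cons.
set zs := gram_schmidt ys in IHys *; set r := z - _.
have rP : r *m orthproj zs = 0.
  by rewrite mulmxBl orthproj_idem ?subrr // => ?; exact: gram_schmidt_fix.
rewrite inE /=; case: ifP => [/eqP r0|/negbT r0].
  have /eqP := dotv_eq0 r0; rewrite subr_eq0 => /eqP zE.
  by case/orP => [/eqP ->|/IHys].
rewrite orthproj_cons mulmxDr -scalemxAr mulmxA [y *m r^T]mx11_scalar.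
rewrite mul_scalar_mx scalerA -/(dotv y r) => /orP[/eqP ->|/IHys yP].
  have -> : dotv z r = dotv r r.
    rewrite -[z in LHS](subrK (z *m orthproj zs)) -/r /dotv mulmxDl.
    rewrite -mulmxA -[orthproj zs in X in _ + X]orthproj_sym -trmx_mul rP.
    by rewrite trmx0 mulmx0 addr0.
  by rewrite mulVf // scale1r subrK.
suff -> : dotv y r = 0 by rewrite mulr0 scale0r add0r.
rewrite -{1}yP /dotv -mulmxA -[orthproj zs]orthproj_sym -trmx_mul rP.
by rewrite trmx0 mulmx0 mxE.
Qed.

Lemma sub_proj_span ys x : (x <= proj_span ys)%MS -> x *m proj_span ys = x.
Proof. by case/submxP => D ->; exact: proj_span_idem. Qed.

Lemma proj_span_sub ys q (V : 'M[F]_(q, n)) :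
  (forall y, y \in ys -> (y <= V)%MS) -> (proj_span ys <= V)%MS.
Proof.
move=> ysV; apply/row_subP => i; rewrite rowE -[proj_span ys]mulmx1 mulmxA.
by apply: (proj_span_ind (K := fun x => (x *m 1%:M <= V)%MS)) => [|y /ysV];
  [exact: subspace_submx|rewrite mulmx1].
Qed.

Lemma mem_proj_span ys y : y \in ys -> (y <= proj_span ys)%MS.
Proof. by move=> /proj_span_fix {1}<-; exact: submxMl. Qed.

Lemma closurev_ind (K : 'rV[F]_n -> Prop) As ys k : (forall y, y \in ys -> K y) ->
  (forall A y, A \in As -> K y -> K (y *m A^T)) ->
  forall y, y \in closurev As ys k -> K y.
Proof.
move=> Kys KA; elim: k => //= k IHk y; rewrite mem_cat => /orP[/IHk //|].
by case/flatten_mapP => A AAs /mapP[z /IHk Kz ->]; exact: KA.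
Qed.

Lemma closurev_leq As ys k l : (k <= l)%N ->
  {subset closurev As ys k <= closurev As ys l}.
Proof.
by move/subnK <-; elim: (l - k)%N => //= d IHd y /IHd yd; rewrite mem_cat yd.
Qed.

Lemma closurev_step As ys k A y : A \in As -> y \in closurev As ys k ->
  y *m A^T \in closurev As ys k.+1.
Proof.
move=> AAs yk /=; rewrite mem_cat; apply/orP; right.
by apply/flatten_mapP; exists A => //; apply/mapP; exists y.
Qed.

(** A step that adds nothing to the span shows the span to be invariant under all of [As], so no
    later step adds anything. *)
Lemma closurev_stable As ys k : (proj_span (closurev As ys k.+1) <=
    proj_span (closurev As ys k))%MS ->
  forall l, (proj_span (closurev As ys l) <= proj_span (closurev As ys k))%MS.
Proof.
move=> stab l; apply: proj_span_sub; apply: closurev_ind => [y yys|A y AAs].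
  by apply: mem_proj_span; apply: (@closurev_leq _ _ 0).
case/submxP => D ->.
apply: (proj_span_ind (K := fun x => (x *m A^T <= _)%MS)) => [|z zk].
  exact: subspace_submx.
by apply: submx_trans stab; apply: mem_proj_span; exact: closurev_step.
Qed.

(* The ranks of [n + 2] spans cannot be strictly increasing. *)
Lemma closurev_closed As ys A y : A \in As -> y \in closurev As ys n ->
  y *m A^T *m proj_span (closurev As ys n) = y *m A^T.
Proof.
move=> AAs yn; apply: sub_proj_span.
apply: (submx_trans (B := proj_span (closurev As ys n.+1))).
  by apply: mem_proj_span; exact: closurev_step.
set V := fun k => proj_span (closurev As ys k); rewrite -/(V _) -/(V _).
have Vleq k l : (k <= l)%N -> (V k <= V l)%MS.
  by move=> /closurev_leq sub; apply: proj_span_sub => z /sub; exact: mem_proj_span.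
(* Were step [n] strict, every earlier step would be strict too by [closurev_stable], and each would
   raise the rank. *)
apply: contraT => grow; have rankV k : (k <= n.+1)%N -> (k <= \rank (V k))%N.
  elim: k => // k IHk kn; apply: (leq_ltn_trans (IHk (ltnW kn))).
  rewrite ltn_neqAle (mxrankS (Vleq _ _ (leqnSn k))) andbT.
  apply: contra grow => eqr; apply: submx_trans (Vleq k n kn).
  apply: closurev_stable; move: eqr.
  by rewrite (mxrank_leqif_sup (Vleq _ _ (leqnSn k))).
by have := rankV n.+1 (leqnn _); rewrite leqNgt ltnS rank_leq_row.
Qed.

Lemma closurev_proj_comm As ys A : A \in As ->
  let P := proj_span (closurev As ys n) in P *m A^T *m P = P *m A^T.
Proof.
move=> AAs P; apply/row_matrixP => i; rewrite !row_mul rowE.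
rewrite -[RHS]mulmx1; apply: (proj_span_ind
  (K := fun x => x *m A^T *m P = x *m A^T *m 1%:M)); first exact: subspace_mx.
by move=> y yn; rewrite mulmx1; exact: closurev_closed.
Qed.

End Projections.

(** * Limits of matrices and infinite words *)

Section MatrixLimits.
Context {R : realType} {T : Type} {F : set_system T} {FF : Filter F}.

Lemma cvg_mxP p q (M : T -> 'M[R]_(p, q)) (L : 'M[R]_(p, q)) :
  M @ F --> L <-> forall i j, (fun t => M t i j) @ F --> L i j.
Proof.
split=> [/cvg_ballP ML i j|ML].
  by apply/cvg_ballP => e /ML; apply: filterS => t [_]; exact.
apply/cvg_ballP => e e0; near=> t; split=> //.
near: t; apply: filter_forall => i; apply: filter_forall => j.
by have /cvg_ballP := ML i j; exact.
Unshelve. all: by end_near. Qed.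

Lemma cvg_mulmx p q r s (K : 'M[R]_(r, p)) (M : T -> 'M[R]_(p, q))
    (L : 'M[R]_(p, q)) (N : 'M[R]_(q, s)) :
  M @ F --> L -> (fun t => K *m M t *m N) @ F --> K *m L *m N.
Proof.
move=> /cvg_mxP ML; apply/cvg_mxP => i j; rewrite mxE.
under eq_fun do rewrite mxE.
apply: cvg_big => [|l _]; first exact: add_continuous.
apply: cvgMr_tmp; rewrite mxE; under eq_fun do rewrite mxE.
apply: cvg_big => [|h _]; first exact: add_continuous.
exact: cvgMl_tmp.
Qed.

End MatrixLimits.

(** * Infinite words, cylinders and uniform limits *)

Section Words.
Variables (R : realType) (S : finType).
Implicit Types (w : oword R S) (u v : seq S).

Definition wdrop w k : oword R S := fun i => w (k + i)%N.
Definition wcons a w : oword R S := fun i => if i is i'.+1 then w i' else a.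

Lemma size_pref w k : size (pref w k) = k.
Proof. exact: size_mkseq. Qed.

Lemma pref_wcons a w k : pref (wcons a w) k.+1 = a :: pref w k.
Proof. by rewrite /pref /mkseq /= -[1%N]addn0 iotaDl -map_comp. Qed.

Lemma pref_add w k l : pref w (k + l) = pref w k ++ pref (wdrop w k) l.
Proof.
rewrite /pref /mkseq iotaD map_cat add0n; congr (_ ++ _).
by rewrite -[in LHS](addn0 k) iotaDl -map_comp.
Qed.

Lemma pref_leq w w' k l : (k <= l)%N -> pref w l = pref w' l -> pref w k = pref w' k.
Proof.
move=> kl /(congr1 (take k)); rewrite -(subnKC kl) !pref_add.
by rewrite !take_size_cat // size_pref.
Qed.

Lemma oword_extension (next : seq S -> S) v : exists w,
  pref w (size v) = v /\
  forall k, (size v <= k)%N -> pref w k.+1 = rcons (pref w k) (next (pref w k)).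
Proof.
pose ext k := iter k (fun u => rcons u (next u)) v.
have size_ext k : size (ext k) = (size v + k)%N.
  by elim: k => [|k IHk]; rewrite ?addn0 // addnS -IHk /= size_rcons.
(* [next [::]] is the default letter of [nth]. The approximations extend one another, so letter [i]
   can be read off [ext i.+1], which is long enough. *)
pose w : oword R S := fun i => nth (next [::]) (ext i.+1) i.
have nth_ext k l i : (k <= l)%N -> (i < size (ext k))%N ->
    nth (next [::]) (ext l) i = nth (next [::]) (ext k) i.
  move=> /subnK <-; elim: (l - k)%N => //= d IHd ik.
  rewrite nth_rcons size_ext ifT ?IHd // (leq_trans ik) //.
  by rewrite size_ext leq_add2l leq_addl.
have pref_w k : pref w (size v + k) = ext k.
  apply: (@eq_from_nth _ (next [::])) => [|i]; rewrite size_pref ?size_ext // => ik.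
  rewrite nth_mkseq // /w; case: (leqP i.+1 k) => ki.
    by rewrite -(nth_ext _ _ _ ki) // size_ext; exact: leq_addl.
  by rewrite (nth_ext k) ?size_ext // ltnW.
exists w; split=> [|k /subnKC <-]; first by rewrite -[size v]addn0 pref_w.
by rewrite -addnS !pref_w.
Qed.

Lemma koenig (T : seq S -> Prop) :
  (forall u v, T (u ++ v) -> T u) ->
  (forall N, exists2 v, size v = N & T v) ->
  exists w, forall k, T (pref w k).
Proof.
move=> Tpre Tinf.
(* The invariant of the construction; since the alphabet is finite, some letter preserves it. *)
pose ext u := forall N, exists2 v, size v = N & T (u ++ v).
have /choice[next ext_next] : forall u, exists a, ext u -> ext (rcons u a).
  move=> u; apply: contrapT => /forallNP noext.
  have [a0 _] : exists a : S, True.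
    by have [[|a v] // _ _] := Tinf 1%N; exists a.
  have extu : ext u by apply: contrapT => nextu; apply: (noext a0).
  have /choice[N hN] a : exists N, forall v, size v = N -> ~ T (rcons u a ++ v).
    apply: contrapT => /forallNP hN; apply: (noext a) => _ N.
    apply: contrapT => no; apply: (hN N) => v sv Tv; apply: no.
    by exists v.
  (* After its first letter [a], this continuation still has at least [N a] letters. *)
  have [[|a v] // [sv] Tv] := extu (\max_a N a).+1.
  apply: (hN a (take (N a) v)).
    by rewrite size_takel // sv leq_bigmax.
  by apply: (Tpre _ (drop (N a) v)); rewrite -catA cat_take_drop cat_rcons.
have [w [_ wE]] := oword_extension next [::].
exists w => k; have : ext (pref w k).
  elim: k => [|k IHk]; last by rewrite wE //; exact: ext_next.
  by move=> N; exact: Tinf.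
by move=> /(_ 0%N)[v _]; exact: Tpre.
Qed.

Lemma nbhs_oword w (P : set (oword R S)) :
  nbhs w P <-> exists k, forall w', pref w' k = pref w k -> P w'.
Proof.
split=> [/nbhs_ballP[e /= e0 eP]|[k kP]].
  have [k ke] : exists k, 2 ^- k < e :> R.
    have [k _ /(_ k (leqnn _)) ke] := near_infty_natSinv_expn_lt (PosNum e0).
    by exists k; move: ke; rewrite /= div1r.
  exists k.+1 => w' ww'; apply: eP; rewrite ballEmdist /=.
  by apply: lt_trans ke; apply/dC_lt_pref.
apply/nbhs_ballP; exists (2 ^- k); first by rewrite /= invr_gt0 exprn_gt0.
move=> w'; rewrite ballEmdist /= => /dC_lt_pref eqp; apply: kP.
by symmetry; apply: pref_leq eqp.
Qed.

(** The maps sending [w] to [g (pref w k)] are locally constant and converge uniformly, so their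
    limit is continuous. *)
Lemma uniformly_cauchy_cvg (g : seq S -> R) :
  (forall e, 0 < e -> exists N, forall v u, (N <= size v)%N ->
    `|g (v ++ u) - g v| <= e) ->
  (forall w, cvgn (fun k => g (pref w k))) /\
  continuous (fun w => limn (fun k => g (pref w k))).
Proof.
move=> gC; have g_cvg w : cvgn (fun k => g (pref w k)).
  apply: cauchy_cvg; apply: cauchy_exP => e e0.
  have [N hN] := gC (e / 2) (divr_gt0 e0 (ltr0n _ 2)).
  exists (g (pref w N)); exists N => // k /= Nk.
  rewrite -(subnKC Nk) pref_add /ball /= distrC.
  by rewrite (le_lt_trans (hN _ _ _)) ?size_pref // gtr_pMr // invf_lt1 // ltr1n.
split=> // w; apply/(cvgrPdist_le (FF := nbhs_filter w)) => e e0.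
have [N hN] := gC (e / 2) (divr_gt0 e0 (ltr0n _ 2)).
have near_lim w' : `|limn (fun k => g (pref w' k)) - g (pref w' N)| <= e / 2.
  have: (fun k => g (pref w' k) - g (pref w' N)) @ \oo -->
      limn (fun k => g (pref w' k)) - g (pref w' N).
    by apply: cvgB; [exact: g_cvg|exact: cvg_cst].
  move=> /cvg_norm h; rewrite -(cvg_lim _ h) //.
  apply: limr_le; first by apply/cvg_ex; eexists; exact: h.
  exists N => // k /= Nk; rewrite -(subnKC Nk) pref_add.
  by apply: hN; rewrite size_pref.
apply/nbhs_oword; exists N => w' ww'.
rewrite -(subrK (g (pref w N)) (limn _)) -addrA (splitr e).
apply: le_trans (ler_normD _ _) _; apply: lerD; first exact: near_lim.
by rewrite distrC -ww'; exact: near_lim.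
Qed.

End Words.

(** * Stable families are uniformly contracting *)

Section EntrySumNorm.
Variable R : realDomainType.

(** Chosen because it is submultiplicative, unlike the maximum norm. *)
Definition nrm p q (M : 'M[R]_(p, q)) := \sum_i \sum_j `|M i j|.

Lemma nrm_ge0 p q (M : 'M[R]_(p, q)) : 0 <= nrm M.
Proof. by apply: sumr_ge0 => i _; apply: sumr_ge0. Qed.

Lemma nrm_entry p q (M : 'M[R]_(p, q)) i j : `|M i j| <= nrm M.
Proof.
rewrite /nrm (bigD1 i) //= (bigD1 j) //= -addrA lerDl.
by rewrite addr_ge0 ?sumr_ge0 // => k _; apply: sumr_ge0.
Qed.

Lemma nrmD p q (M N : 'M[R]_(p, q)) : nrm (M + N) <= nrm M + nrm N.
Proof.
rewrite /nrm -big_split /=; apply: ler_sum => i _.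
rewrite -big_split /=; apply: ler_sum => j _.
by rewrite mxE ler_normD.
Qed.

Lemma nrmN p q (M : 'M[R]_(p, q)) : nrm (- M) = nrm M.
Proof. by apply: eq_bigr => i _; apply: eq_bigr => j _; rewrite mxE normrN. Qed.

Lemma nrmM p q r (M : 'M[R]_(p, q)) (N : 'M[R]_(q, r)) :
  nrm (M *m N) <= nrm M * nrm N.
Proof.
rewrite /nrm mulr_suml; apply: ler_sum => i _.
apply: (@le_trans _ _ (\sum_k \sum_j `|M i k| * `|N k j|)).
  rewrite exchange_big; apply: ler_sum => j _; rewrite mxE.
  apply: le_trans (ler_norm_sum _ _ _) _.
  by apply: ler_sum => k _; rewrite normrM.
rewrite mulr_suml; apply: ler_sum => k _; rewrite -mulr_sumr ler_wpM2l //.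
by rewrite [leRHS](bigD1 k) //= lerDl sumr_ge0 // => l _; exact: sumr_ge0.
Qed.

End EntrySumNorm.

Section Products.
Variables (R : realType) (S : finType) (n : nat) (C : S -> 'M[R]_n).
Implicit Types (u v : seq S).

Lemma word_mx_nil : word_mx C [::] = 1%:M.
Proof. by rewrite /word_mx big_nil. Qed.

Lemma word_mx_cons a v : word_mx C (a :: v) = C a *m word_mx C v.
Proof. by rewrite /word_mx big_cons. Qed.

Lemma word_mx_cat u v : word_mx C (u ++ v) = word_mx C u *m word_mx C v.
Proof. by rewrite /word_mx big_cat. Qed.

Lemma word_mx1 a : word_mx C [:: a] = C a.
Proof. by rewrite word_mx_cons word_mx_nil mulmx1. Qed.

Lemma word_mx_bounded N : exists2 b, 0 <= b & forall v, (size v <= N)%N ->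
  nrm (word_mx C v) <= b.
Proof.
elim: N => [|N [b b0 hb]].
  by exists (nrm (word_mx C [::])) => [|[]]; rewrite ?nrm_ge0.
pose c := nrm (word_mx C [::]) + \sum_a nrm (C a) * b.
have c0 a : 0 <= nrm (C a) * b by rewrite mulr_ge0 ?nrm_ge0.
exists c => [|[|a v] sv]; first by rewrite addr_ge0 ?nrm_ge0 ?sumr_ge0.
  by rewrite lerDl sumr_ge0.
rewrite word_mx_cons (le_trans (nrmM _ _)) //.
apply: le_trans (ler_wpM2l (nrm_ge0 _) (hb _ sv)) _.
rewrite /c (bigD1 a) //= addrCA lerDl addr_ge0 ?nrm_ge0 //.
by apply: sumr_ge0.
Qed.

Hypothesis C_stable : stable C.

(* A word with no short contracting prefix extends, by Koenig's lemma, to an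
   infinite word along which the products do not tend to 0. *)
Lemma stable_block : exists N, forall v, size v = N ->
  exists j, (0 < j <= N)%N /\ nrm (word_mx C (take j v)) <= 2^-1.
Proof.
apply: contrapT => /forallNP noN.
have [||w hw] := @koenig R S (fun v => forall j, (0 < j <= size v)%N ->
    ~ nrm (word_mx C (take j v)) <= 2^-1).
- move=> u v huv j /andP[j0 ju]; have := huv j.
  rewrite take_cat size_cat j0 (leq_trans ju (leq_addr _ _)) => /(_ isT).
  move: ju; rewrite leq_eqVlt => /orP[/eqP ->|->] //.
  by rewrite ltnn subnn take0 cats0 take_size.
- move=> N; have /existsNP[v /not_implyP[sv /forallNP hv]] := noN N.
  by exists v => // j jN=> hj; apply: (hv j); rewrite -sv.
have /cvg_mxP Cw := C_stable w.
have : \forall k \near \oo, nrm (word_mx C (pref w k)) <= 2^-1.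
  (* With this bound the [n * n] entries add up to at most 1/2; the successor keeps the denominator
     positive when [n = 0]. *)
  have e0 : 0 < (2 * (n * n).+1%:R)^-1 :> R by rewrite invr_gt0 mulr_gt0.
  have : \forall k \near \oo, forall i j,
      `|word_mx C (pref w k) i j| <= (2 * (n * n).+1%:R)^-1.
    apply: filter_forall => i; apply: filter_forall => j.
    have /cvgrPdist_le/(_ _ e0) := Cw i j; apply: filterS => k.
    by rewrite mxE sub0r normrN.
  apply: filterS => k small.
  apply: (@le_trans _ _ (\sum_(i < n) \sum_(j < n) (2 * (n * n).+1%:R)^-1)).
    by do 2!apply: ler_sum => ? _.
  rewrite !sumr_const !card_ord -mulrnA -[_ *+ (n * n)]mulr_natr invfM -mulrA.
  by rewrite ger_pMr ?invr_gt0 // mulrC ler_pdivrMr // mul1r ler_nat leqW.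
(* The index [k.+1] makes the contracting prefix nonempty. *)
move=> [k _ /(_ k.+1 (leqnSn k))] /=; apply: contraPP => hk.
have := hw k.+1 k.+1; rewrite size_pref leqnn => /(_ isT).
by rewrite -[X in take X](size_pref w k.+1) take_size.
Qed.

Lemma stable_split : exists N, forall v, (N <= size v)%N ->
  exists v1 v2, [/\ v = v1 ++ v2, (0 < size v1 <= N)%N &
    nrm (word_mx C v1) <= 2^-1].
Proof.
have [N hN] := stable_block; exists N => v Nv.
have [|j [/andP[j0 jN] hj]] := hN (take N v); first by rewrite size_takel.
rewrite take_takel // in hj; exists (take j v), (drop j v).
split=> //; first by rewrite cat_take_drop.
by rewrite size_takel ?(leq_trans jN) ?j0.
Qed.

(** Contracting prefixes are peeled off until at most [N] letters remain; each factor of norm at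
    most 1/2 only lowers the bound. *)
Lemma stable_bounded : exists2 b, 0 <= b & forall v, nrm (word_mx C v) <= b.
Proof.
have [N hN] := stable_split; have [b b0 hb] := word_mx_bounded N.
exists b => // v; have [m] := ubnP (size v); elim: m v => // m IHm v vm.
have [vN|/ltnW Nv] := leqP (size v) N; first exact: hb.
have [v1 [v2 [vE /andP[v10 _] hv1]]] := hN v Nv.
rewrite vE word_mx_cat (le_trans (nrmM _ _)) //.
have hv2 : nrm (word_mx C v2) <= b.
  apply: IHm; rewrite -ltnS; apply: leq_trans vm; rewrite vE size_cat ltnS.
  by rewrite -addn1 addnC leq_add2r.
apply: le_trans (ler_pM (nrm_ge0 _) (nrm_ge0 _) hv1 hv2) _.
by rewrite -[leRHS]mul1r ler_wpM2r // invf_le1 ?ler1n.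
Qed.

Lemma stable_decay e : 0 < e -> exists N, forall v, (N <= size v)%N ->
  nrm (word_mx C v) <= e.
Proof.
move=> e0; have [N hN] := stable_split; have [b b0 hb] := stable_bounded.
(* Such a word starts with [k] contracting blocks, and [b] bounds the product over the rest. *)
have decay k v : (k * N <= size v)%N -> nrm (word_mx C v) <= b / 2 ^+ k.
  elim: k v => [|k IHk] v; first by rewrite divr1.
  rewrite mulSn => Nv; have [v1 [v2 [vE /andP[_ v1N] hv1]]] :=
    hN v (leq_trans (leq_addr _ _) Nv).
  rewrite vE word_mx_cat (le_trans (nrmM _ _)) // exprS invfM mulrCA.
  apply: ler_pM => //; rewrite ?nrm_ge0 // IHk //.
  by rewrite -(leq_add2l N) (leq_trans Nv) // vE size_cat leq_add2r.
have [k _ /(_ k (leqnn k)) /= hk] := near_infty_natSinv_expn_lt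
  (PosNum (divr_gt0 e0 (ltr_wpDl b0 ltr01))).
exists (k * N)%N => v /decay /le_trans; apply.
move: hk; rewrite div1r ltr_pdivlMr ?ltr_wpDl // => /ltW.
by apply: le_trans; rewrite mulrC ler_wpM2l ?invr_ge0 ?exprn_ge0 // lerDl.
Qed.

(** Peeling off a contracting block reproduces the bound [b + b], since half of it plus [b] is again
    [b + b]. *)
Lemma stable_cocycle_bounded p (D : seq S -> 'M[R]_(n, p)) :
  (forall u v, D (u ++ v) = word_mx C u *m D v + D u) ->
  (forall N, exists2 b, 0 <= b & forall v, (size v <= N)%N -> nrm (D v) <= b) ->
  exists2 b, 0 <= b & forall v, nrm (D v) <= b.
Proof.
move=> Dcat Dbnd; have [N hN] := stable_split; have [b b0 hb] := Dbnd N.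
exists (b + b) => [|v]; first by rewrite addr_ge0.
have [m] := ubnP (size v); elim: m v => // m IHm v vm.
have [vN|/ltnW Nv] := leqP (size v) N; first by rewrite (le_trans (hb _ vN)) ?lerDl.
have [v1 [v2 [vE /andP[v10 v1N] hv1]]] := hN v Nv.
rewrite vE Dcat (le_trans (nrmD _ _)) // lerD ?hb //.
have hv2 : nrm (D v2) <= b + b.
  apply: IHm; rewrite -ltnS; apply: leq_trans vm; rewrite vE size_cat ltnS.
  by rewrite -addn1 addnC leq_add2r.
apply: le_trans (nrmM _ _) _.
apply: le_trans (ler_pM (nrm_ge0 _) (nrm_ge0 _) hv1 hv2) _.
by rewrite mulrDr ![2^-1 * b]mulrC -splitr.
Qed.

End Products.

(** * The reduction to stability *)

Section Reduction.
Variables (R : realType) (S : finType) (n : nat).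
Variables (A : S -> 'M[R]_n) (us fs : seq 'rV[R]_n).

Let Q := row_proj [seq A a | a <- enum S] us.

Definition left_reduced a := Q^T *m A a.
Local Notation B := left_reduced.

Let gs := [seq f *m Q | f <- fs].
Let P := col_proj [seq B a | a <- enum S] gs.

Definition reduced a := B a *m P.
Local Notation C := reduced.

Let memA a : A a \in [seq A a | a <- enum S].
Proof. by apply: map_f; rewrite mem_enum. Qed.

Let memB a : B a \in [seq B a | a <- enum S].
Proof. by apply: map_f; rewrite mem_enum. Qed.

Let QT : Q^T = Q. Proof. exact: orthproj_sym. Qed.

Let BE a : B a = Q *m A a. Proof. by rewrite /left_reduced QT. Qed.

Let PT : P^T = P. Proof. exact: orthproj_sym. Qed.

(** The span of the rows [x A_u], onto which [Q] projects, is invariant under right multiplication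
    by [A a]. *)
Let QAQ a : Q *m A a *m Q = Q *m A a.
Proof.
have : Q *m (A a)^T^T *m Q = Q *m (A a)^T^T :=
  closurev_proj_comm _ (map_f trmx (memA a)).
by rewrite trmxK.
Qed.

Let us_Q x : x \in us -> x *m Q = x.
Proof. by move=> xus; apply: proj_span_fix; apply: (@closurev_leq _ _ _ _ 0). Qed.

Let PBP a : P *m B a *m P = B a *m P.
Proof.
have : P *m (B a)^T *m P = P *m (B a)^T := closurev_proj_comm _ (memB a).
move: (B a) => M /(congr1 trmx).
by rewrite !trmx_mul trmxK PT mulmxA.
Qed.

Let P_defect f a : f \in fs -> let g := f *m Q in
  P *m (B a *m g^T - g^T) = B a *m g^T - g^T.
Proof.
move=> ffs g; have : (g *m (B a)^T - g) *m P = g *m (B a)^T - g.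
  apply: proj_span_fix; apply: (@closurev_leq _ _ _ _ 0) => //.
  apply/flatten_mapP; exists (B a) => //; apply/mapP; exists g => //.
  exact: map_f.
by move/(congr1 trmx); rewrite trmx_mul PT linearB /= trmx_mul trmxK.
Qed.

Let word_B_P p v (D : 'M[R]_(n, p)) : P *m D = D ->
  P *m (word_mx B v *m D) = word_mx B v *m D.
Proof.
move=> PD; elim: v => [|a v IHv]; first by rewrite word_mx_nil mul1mx.
rewrite word_mx_cons -mulmxA -IHv; move: (PBP a); move: (B a) => M PMP.
by rewrite !mulmxA PMP.
Qed.

(** The factors [P] inside the product act trivially: every column met on the way is fixed by
    [P]. *)
Let word_CB p v (D : 'M[R]_(n, p)) : P *m D = D ->
  word_mx C v *m D = word_mx B v *m D.
Proof.
move=> PD; elim: v => [|a v IHv]; first by rewrite !word_mx_nil.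
by rewrite !word_mx_cons -!mulmxA IHv word_B_P.
Qed.

Let word_A_Q q (x : 'M[R]_(q, n)) v : x *m Q = x ->
  x *m word_mx A v *m Q = x *m word_mx A v.
Proof.
elim: v x => [|a v IHv] x xQ; first by rewrite word_mx_nil mulmx1.
rewrite word_mx_cons mulmxA IHv //.
by rewrite -xQ -!mulmxA; congr (x *m _); rewrite mulmxA QAQ.
Qed.

Let word_BA q (x : 'M[R]_(q, n)) v : x *m Q = x -> x *m word_mx B v = x *m word_mx A v.
Proof.
elim: v x => [|a v IHv] x xQ; first by rewrite !word_mx_nil.
rewrite !word_mx_cons !mulmxA QT xQ IHv //.
by have := word_A_Q [:: a] xQ; rewrite word_mx1.
Qed.

Let word_C v : v != [::] -> word_mx C v = Q *m word_mx A v *m P.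
Proof.
move=> v0; have -> : word_mx C v = word_mx B v *m P.
  case/lastP: v v0 => // v a _; rewrite -cats1 !word_mx_cat !word_mx1 word_CB.
    by rewrite -mulmxA.
  by rewrite /reduced mulmxA PBP.
case: v v0 => // a v _; rewrite !word_mx_cons mulmxA BE.
by rewrite word_BA ?QAQ.
Qed.

(** The cocycle [A_u f - f], seen through [Q]. *)
Let D (f : 'rV[R]_n) u := word_mx B u *m (f *m Q)^T - (f *m Q)^T.

Let D_cat f u v : D f (u ++ v) = word_mx B u *m D f v + D f u.
Proof. by rewrite /D word_mx_cat mulmxBr mulmxA addrA subrK. Qed.

Let P_D f u : f \in fs -> P *m D f u = D f u.
Proof.
move=> ffs; elim: u => [|a u IHu].
  by rewrite /D word_mx_nil mul1mx subrr mulmx0.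
rewrite -cat1s D_cat mulmxDr word_B_P // /D word_mx1.
by rewrite P_defect.
Qed.

(** The difference equals [x C_v (D f u)], where [C_v] is uniformly small for long [v] and [D f] is
    bounded. *)
Lemma stable_weights x f : stable C -> x \in us -> f \in fs ->
  forall e, 0 < e -> exists N, forall v u, (N <= size v)%N ->
  `|(x *m word_mx A (v ++ u) *m f^T) 0 0 - (x *m word_mx A v *m f^T) 0 0| <= e.
Proof.
move=> C_stable xus ffs e e0; have xQ := us_Q xus.
have [||b b0 hb] := stable_cocycle_bounded C_stable (D := D f).
- by move=> u v; rewrite D_cat word_CB // P_D.
- move=> N; have [c c0 hc] := word_mx_bounded B N.
  exists (c * nrm (f *m Q)^T + nrm (f *m Q)^T).
    by rewrite addr_ge0 ?mulr_ge0 ?nrm_ge0.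
  move=> v /hc vc; rewrite (le_trans (nrmD _ _)) // nrmN lerD2r.
  by rewrite (le_trans (nrmM _ _)) // ler_wpM2r ?nrm_ge0.
have c0 : 0 < nrm x * b + 1 by rewrite ltr_wpDl ?mulr_ge0 ?nrm_ge0.
have [N hN] := stable_decay C_stable (divr_gt0 e0 c0).
exists N => v u /hN Cv.
have weightE w : x *m word_mx A w *m f^T = x *m word_mx B w *m (f *m Q)^T.
  by rewrite word_BA // trmx_mul QT mulmxA word_A_Q.
have -> : (x *m word_mx A (v ++ u) *m f^T) 0 0 - (x *m word_mx A v *m f^T) 0 0 =
    (x *m word_mx C v *m D f u) 0 0.
  rewrite !weightE -[x *m word_mx C v *m _]mulmxA word_CB ?P_D //.
  rewrite /D mulmxBr mulmxA -word_mx_cat mulmxBr !mulmxA.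
  by rewrite [RHS]mxE; congr (_ + _); rewrite [RHS]mxE.
apply: le_trans (nrm_entry _ _ _) _; rewrite -mulmxA.
apply: le_trans (nrmM _ _) _.
apply: (@le_trans _ _ (nrm x * (e / (nrm x * b + 1) * b))).
  apply: ler_wpM2l; first exact: nrm_ge0.
  by rewrite (le_trans (nrmM _ _)) // ler_pM ?nrm_ge0.
rewrite [e / _ * b]mulrAC mulrA ler_pdivrMr // mulrCA.
by rewrite ler_pM2l // lerDl.
Qed.

(** Linearity carries the hypothesis from the generators to all rows of [Q] and all columns of [P].
    Quantifying over [w] and [u] lets it survive the closure steps, which add a letter at either
    end. *)
Lemma weights_stable :
  (forall x f, x \in us -> f \in fs -> forall (w : oword R S) u b,
    (fun k => (x *m word_mx A (pref w k) *m word_mx A u *m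
               (A b *m f^T - f^T)) 0 0) @ \oo --> (0 : R)) ->
  stable C.
Proof.
have lin_cvg (x y : nat -> R) c : x @ \oo --> (0 : R) -> y @ \oo --> (0 : R) ->
    (fun k => c * x k + y k) @ \oo --> (0 : R).
  move=> x0 y0; rewrite -[0]addr0 -[X in nbhs (X + _)](mulr0 c).
  by apply: cvgD => //; exact: cvgMl_tmp.
move=> H.
have left_Q (x : 'rV[R]_n) f : f \in fs -> forall (w : oword R S) u b,
    (fun k => (x *m Q *m word_mx A (pref w k) *m word_mx A u *m
               (A b *m f^T - f^T)) 0 0) @ \oo --> (0 : R).
  move=> ffs; pose K (z : 'rV[R]_n) := forall (w : oword R S) u b,
    (fun k => (z *m word_mx A (pref w k) *m word_mx A u *m
               (A b *m f^T - f^T)) 0 0) @ \oo --> (0 : R).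
  suff : K (x *m Q) by []; apply: proj_span_ind.
    split=> [w u b|c y z hy hz w u b].
      by under eq_fun do rewrite !mul0mx mxE; exact: cvg_cst.
    under eq_fun do rewrite !mulmxDl -!scalemxAl 2!mxE.
    exact: lin_cvg.
  apply: closurev_ind => [y yus|M y]; first exact: H.
  case/mapP => _ /mapP[a _ ->] -> hy w u b; rewrite trmxK.
  (* Multiplying the row by [A a] amounts to prepending [a] to the infinite word and shifting the
     index. *)
  have := hy (wcons a w) u b; rewrite -cvg_shiftS.
  by under eq_fun do rewrite pref_wcons word_mx_cons mulmxA.
have right_P (x y : 'rV[R]_n) (w : oword R S) u :
    (fun k => (x *m Q *m word_mx A (pref w k) *m word_mx A u *m
               (y *m P)^T) 0 0) @ \oo --> (0 : R).
  pose K (z : 'rV[R]_n) := forall (w : oword R S) u,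
    (fun k => (x *m Q *m word_mx A (pref w k) *m word_mx A u *m
               z^T) 0 0) @ \oo --> (0 : R).
  move: w u; suff : K (y *m P) by []; apply: proj_span_ind.
    split=> [w u|c z t hz ht w u].
      by under eq_fun do rewrite trmx0 mulmx0 mxE; exact: cvg_cst.
    under eq_fun do rewrite linearD linearZ /= mulmxDr -scalemxAr 2!mxE.
    exact: lin_cvg.
  have xQ v : x *m Q *m word_mx A v *m Q = x *m Q *m word_mx A v.
    by apply: word_A_Q; exact: proj_span_idem.
  apply: closurev_ind => [y' |M y' /mapP[a _ ->] hy' w u].
    case/flatten_mapP => M /mapP[a _ ->] /mapP[g /mapP[f ffs ->] ->] w u.
    apply: cvg_trans (left_Q x f ffs w u a); apply: near_eq_cvg.
    apply: nearW => k; rewrite -![_ *m word_mx A u]mulmxA -word_mx_cat.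
    set v := pref w k ++ u.
    have := xQ (v ++ [:: a]); rewrite word_mx_cat word_mx1 mulmxA => xAQ.
    rewrite BE [(_ - _)^T]linearB /= !trmx_mul !trmxK QT.
    by rewrite !mulmxBr !mulmxA xQ xAQ.
  (* The factor [B a] is absorbed by appending [a] to [u]; its [Q] disappears because the row on its
     left is fixed by [Q]. *)
  apply: cvg_trans (hy' w (u ++ [:: a])); apply: near_eq_cvg.
  apply: nearW => k; rewrite BE !trmx_mul !trmxK.
  rewrite word_mx_cat word_mx1 !mulmxA; congr (_ 0 0); congr (_ *m _).
  by rewrite -![_ *m word_mx A u]mulmxA -word_mx_cat xQ.
move=> w; apply/cvg_mxP => i j; rewrite mxE.
apply: cvg_trans (right_P (delta_mx 0 i) (delta_mx 0 j) w [::]).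
apply: near_eq_cvg; exists 1%N => // k /= k0; rewrite /prefix_products word_C.
  rewrite word_mx_nil mulmx1 trmx_mul PT trmx_delta -rowE mulmxA -colE.
  by rewrite -!row_mul !mxE.
by rewrite -size_eq0 size_pref -lt0n.
Qed.

End Reduction.

(** * Continuity criteria *)

Section WeightedAutomata.
Variables (R : realType) (S : finType) (a0 : S) (A : wfa R S).

Let g v := (initial A *m word_mx (trans A) v *m final A) 0 0.

Hypothesis avg : average_preserving A.

(** [g v] is the mean of the values [g (rcons v a)], so after scaling by [c] they cannot all lie
    strictly below it. *)
Lemma average_preserving_step (c : R) v : exists a, c * g v <= c * g (rcons v a).
Proof.
apply: contrapT => /forallNP small.
have sumg : \sum_a c * g (rcons v a) = c * g v *+ #|S|.
  rewrite -mulr_sumr -mulrnAr; congr (c * _); rewrite /g.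
  transitivity ((initial A *m word_mx (trans A) v *m
    (\sum_a trans A a *m final A)) 0 0).
    rewrite mulmx_sumr summxE; apply: eq_bigr => a _.
    by rewrite -cats1 word_mx_cat word_mx1 !mulmxA.
  by rewrite avg -scalemxAr mxE mulr_natl.
suff : \sum_a c * g (rcons v a) < \sum_(a : S) c * g v.
  by rewrite sumg sumr_const ltxx.
apply: ltr_sum => [|a _]; last by rewrite ltNge; apply/negP; exact: small.
by apply/hasP; exists a0 => //; rewrite mem_index_enum.
Qed.

Hypothesis g_cvg : forall w : oword R S, cvgn (fun k => g (pref w k)).

Let f (w : oword R S) := limn (fun k => g (pref w k)).

(* With [c = 1] and [c = -1]: [g v] lies between two values of [f] on the cylinder
   of [v]. *)
Lemma average_preserving_extension (c : R) v :
  exists w : oword R S, pref w (size v) = v /\ c * g v <= c * f w.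
Proof.
have [next nextP] := choice (average_preserving_step c).
have [w [wv wS]] := oword_extension R next v; exists w; split=> //.
have : (fun k => c * g (pref w k)) @ \oo --> c * f w by apply: cvgMl_tmp; exact: g_cvg.
move=> cg; rewrite -(cvg_lim _ cg) //; apply: limr_ge.
  by apply/cvg_ex; exists (c * f w).
exists (size v) => // k /= /subnKC <-; elim: (k - size v)%N => [|d IHd].
  by rewrite addn0 wv.
by rewrite addnS wS ?leq_addr // (le_trans IHd).
Qed.

(** The value of [g] is squeezed between two values of [f] on a cylinder where [f] stays within [e]
    of [f w]. *)
Lemma continuous_weights_near : continuous f -> forall w e, 0 < e ->
  exists N, forall v, `|g (pref w N ++ v) - f w| <= e.
Proof.
move=> f_cont w e e0.
have /(cvgrPdist_le (FF := nbhs_filter w))/(_ e e0)/nbhs_oword[N hN] := f_cont w.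
exists N => v; set u := pref w N ++ v.
have near_f w' : pref w' (size u) = u -> `|f w - f w'| <= e.
  move=> w'u; apply: hN; move: w'u; rewrite /u size_cat size_pref pref_add.
  by move=> /eqP; rewrite eqseq_cat ?size_pref // => /andP[/eqP ->].
have [w1 [/near_f h1 le1]] := average_preserving_extension 1 u.
have [w2 [/near_f h2 le2]] := average_preserving_extension (-1) u.
move: le1 le2 h1 h2; rewrite !mul1r !mulN1r lerN2 !ler_norml.
by move=> *; apply/andP; split; lra.
Qed.

End WeightedAutomata.

Lemma omega_continuousP (R : realType) (S : finType) (a0 : S) (A : wfa R S) :
  average_preserving A ->
  omega_function_continuous A <->
  stable (reduced (trans A) [:: initial A] [:: (final A)^T]).
Proof.
move=> avg; pose g v := (initial A *m word_mx (trans A) v *m final A) 0 0.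
split=> [[g_cvg f_cont]|C_stable].
  apply: weights_stable => x f; rewrite !inE => /eqP -> /eqP -> w u b.
  apply/cvgrPdist_le => e e0; have e2 : 0 < e / 2 by rewrite divr_gt0.
  have [N hN] := continuous_weights_near a0 avg g_cvg f_cont w e2.
  exists N => // k /= Nk; rewrite sub0r normrN trmxK.
  pose v := pref (wdrop w N) (k - N) ++ u.
  (* Both values of [g] are taken at extensions of [pref w N], hence within [e / 2] of the same
     limit. *)
  have -> : (initial A *m word_mx (trans A) (pref w k) *m word_mx (trans A) u *m
      (trans A b *m final A - final A)) 0 0 =
      g (pref w N ++ (v ++ [:: b])) - g (pref w N ++ v).
    rewrite /g /v !catA -pref_add subnKC //.
    rewrite mulmxBr mulmxA !word_mx_cat word_mx1 !mulmxA.
    by rewrite [LHS]mxE; congr (_ + _); rewrite [LHS]mxE.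
  rewrite -[X in `|X|](subrKA (limn (fun k => g (pref w k)))) (splitr e).
  apply: le_trans (ler_normD _ _) _; apply: lerD; first exact: hN.
  by rewrite distrC; exact: hN.
apply: (@uniformly_cauchy_cvg R S g) => e e0.
have [N hN] := stable_weights C_stable (mem_head _ _) (mem_head _ _) e0.
by exists N => v u Nv; have := hN v u Nv; rewrite trmxK.
Qed.

Section ContinuousRCP.
Variables (R : realType) (S : finType) (n : nat) (A : S -> 'M[R]_n).

Let L (w : oword R S) : 'M[R]_n := limn (prefix_products A w).

Hypothesis A_cvg : forall w : oword R S, cvgn (prefix_products A w).

Lemma continuous_RCP_absorb : continuous L -> forall w b, L w *m A b = L w.
Proof.
move=> L_cont w b.
(* [w'] is [pref w k] followed by [b] forever; appending one more [b] only shifts its prefix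
   products beyond [k]. *)
have /choice[W hW] k : exists w', pref w' k = pref w k /\ L w' *m A b = L w'.
  have [w' [w'k w'S]] := oword_extension R (fun=> b) (pref w k).
  rewrite size_pref in w'k w'S; exists w'; split=> //.
  have cvg1 : (fun j => 1%:M *m prefix_products A w' j *m A b) @ \oo -->
      1%:M *m L w' *m A b by apply: cvg_mulmx; exact: A_cvg.
  rewrite mul1mx in cvg1; apply: (cvg_unique (@norm_hausdorff _ _) cvg1).
  have : (fun j => prefix_products A w' j.+1) @ \oo --> L w'.
    by rewrite cvg_shiftS; exact: A_cvg.
  apply: cvg_trans; apply: near_eq_cvg; exists k => // j /= kj.
  by rewrite /prefix_products w'S // -cats1 word_mx_cat word_mx1 mul1mx.
have W_w : W @ \oo --> w.
  move=> P /nbhs_oword[N hN]; exists N => // k /= Nk; apply: hN.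
  by apply: pref_leq Nk _; have [] := hW k.
have LW : (fun k => L (W k)) @ \oo --> L w := cvg_comp _ _ W_w (L_cont w).
have cvg1 : (fun k => 1%:M *m L (W k) *m A b) @ \oo --> 1%:M *m L w *m A b.
  exact: cvg_mulmx.
rewrite mul1mx in cvg1; apply: (cvg_unique (@norm_hausdorff _ _) cvg1).
apply: cvg_trans LW; apply: near_eq_cvg; apply: nearW => k.
by rewrite mul1mx (hW k).2.
Qed.

End ContinuousRCP.

(** With unit vectors on both sides, the weights are the entries of the products. *)
Lemma continuous_RCPP (R : realType) (S : finType) n (A : S -> 'M[R]_n) :
  let e := [seq row i (1%:M : 'M[R]_n) | i <- enum 'I_n] in
  continuous_RCP A <-> stable (reduced A e e).
Proof.
move=> e; have entryE (M : 'M[R]_n) i j :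
    (row i 1%:M *m M *m (row j (1%:M : 'M[R]_n))^T) 0 0 = M i j.
  by rewrite !row1 trmx_delta -rowE -colE !mxE.
have e_row i : row i (1%:M : 'M[R]_n) \in e by apply: map_f; rewrite mem_enum.
split=> [[A_cvg A_cont]|C_stable].
  apply: weights_stable => x f _ _ w u b.
  have absorb := continuous_RCP_absorb A_cvg A_cont w.
  set L := limn _ in absorb.
  (* Since [L] absorbs every product, the weights tend to [x (L A_b - L) f = 0]. *)
  have absorbs v : L *m word_mx A v = L.
    elim: v => [|a v IHv]; first by rewrite word_mx_nil mulmx1.
    by rewrite word_mx_cons mulmxA absorb.
  pose N := word_mx A u *m (A b *m f^T - f^T).
  have /cvg_mxP xLN : (fun k => x *m prefix_products A w k *m N) @ \oo -->
      x *m L *m N by apply: cvg_mulmx; exact: A_cvg.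
  have := xLN 0 0; rewrite -[x *m L *m N]mulmxA [L *m _]mulmxA absorbs mulmxBr.
  rewrite [L *m (A b *m _)]mulmxA absorb subrr mulmx0 mxE.
  by under eq_fun do rewrite mulmxA.
have entries i j := @uniformly_cauchy_cvg R S (fun v => word_mx A v i j).
have {}entries i j :
    (forall w : oword R S, cvgn (fun k => prefix_products A w k i j)) /\
    continuous (fun w : oword R S => limn (fun k => prefix_products A w k i j)).
  apply: entries => d d0.
  have [N hN] := stable_weights C_stable (e_row i) (e_row j) d0.
  by exists N => v u Nv; have := hN v u Nv; rewrite !entryE.
pose L (w : oword R S) := \matrix_(i, j) limn (fun k => prefix_products A w k i j).
have AL w : prefix_products A w @ \oo --> L w.
  by apply/cvg_mxP => i j; rewrite mxE; apply: (entries i j).1.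
split=> [w|]; first by apply/cvg_ex; exists (L w).
rewrite (_ : (fun w => _) = L); last first.
  by apply/funext => w; apply/cvg_lim => //; exact: norm_hausdorff.
move=> w; apply/(cvg_mxP (FF := nbhs_filter w)) => i j; rewrite mxE.
under eq_fun do rewrite mxE.
exact: (entries i j).2.
Qed.

(** * The two reducibilities *)

Lemma code_seq_map T U (c : tree -> U -> Prop) (f : T -> U) t s :
  code_seq (fun t x => c t (f x)) t s <-> code_seq c t [seq f x | x <- s].
Proof.
split; first by elim=> {t s} *; constructor.
elim: s t => [|x s IHs] t h; inversion h; subst; constructor => //.
exact: IHs.
Qed.

(** A many-one reduction: one query on the translated instance, whose answer is returned
    unchanged. *)
Lemma reducible_by (X Y : problem) (f : instance X -> instance Y) :
  (exists p, forall O t x, encodes t x ->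
    exists2 u, run O p t u & encodes u (f x)) ->
  (forall x, positive x <-> positive (f x)) -> reducible X Y.
Proof.
move=> [p hp] posE; exists (PComp PQuery p) => O OY t x tx.
have [u pu ux] := hp O t x tx; have [b Ob bx] := OY u _ ux.
exists b; last by rewrite bx posE.
by apply: run_comp pu _; constructor.
Qed.

Section Reducibility.
Variables (R : realType) (num : tree -> option R).
Hypothesis arith : exact_arithmetic num.

Local Hint Extern 0 (coding _) => exact (num_coding num) : typeclass_instances.

Lemma code_mx_familyE t (A : mx_family R) : code_mx_family num t A <->
  code t [seq mxl (@mf_mx R A a) | a <- enum 'I_(mf_letters A).+1].
Proof.
rewrite /code_mx_family /code_family.
rewrite (code_seq_map (code_seq (code_seq (code_num num))) (@mxl R _ _)).
by rewrite -[X in code_seq _ _ X]map_comp.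
Qed.

Lemma reducel_family m n (A : 'I_m.+1 -> 'M[R]_n) (us fs : seq 'rV[R]_n) :
  reducel [seq mxl (A a) | a <- enum 'I_m.+1] [seq rowl u | u <- us]
    [seq rowl f | f <- fs] =
  [seq mxl (reduced A us fs a) | a <- enum 'I_m.+1].
Proof.
have [a [s es]] : exists a s, enum 'I_m.+1 = a :: s.
  by rewrite enum_ordSl; do 2!eexists.
have AsE : [seq A a | a <- enum 'I_m.+1] = A a :: [seq A b | b <- s] by rewrite es.
have -> : [seq mxl (A a) | a <- enum 'I_m.+1] =
    [seq mxl B | B <- [seq A a | a <- enum 'I_m.+1]] by rewrite -[RHS]map_comp.
rewrite AsE reducel_mxl -AsE.
have -> : [seq (row_proj [seq A a | a <- enum 'I_m.+1] us)^T *m B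
    | B <- [seq A a | a <- enum 'I_m.+1]] =
    [seq left_reduced A us a | a <- enum 'I_m.+1] by rewrite -[LHS]map_comp.
by rewrite -[LHS]map_comp.
Qed.

Definition reduced_family m n (A : 'I_m.+1 -> 'M[R]_n) us fs :=
  MxFamily (reduced A us fs).

Lemma ApWFAContinuity_reducible :
  reducible (ApWFAContinuity num) (MatrixProductStability num).
Proof.
apply: (reducible_by (X := ApWFAContinuity num) (Y := MatrixProductStability num)
  (f := fun A : ap_wfa R => let B := ap_automaton A in
     reduced_family (trans B) [:: initial B] [:: (final B)^T])); last first.
  move=> A; apply: omega_continuousP; first exact: ord0.
  exact: ap_average_preserving.
(* The initial vector is coded as a list of one row, usable directly as [us]; the final one is a
   list of one-entry rows, which [flatten] joins into one vector. *)
have [p hp] : computable (fun x : seq (seq R) * (seq (seq R) * seq (seq (seq R))) =>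
    reducel x.2.2 x.1 [:: flatten x.2.1]).
  apply: (computable_comp3 (computable_reducel arith)); first by computable_var.
    by computable_var.
  apply: computable_cons; last exact: computable_nil.
  by apply: computable_flatten; computable_var.
exists p => O t A [ti [tf [ta [-> It Ft At]]]]; set B := ap_automaton A in It Ft At *.
have [|u pu uC] := hp O (Node ti (Node tf ta))
    (mxl (initial B), (mxl (final B),
       [seq mxl (trans B a) | a <- enum 'I_(ap_letters A).+1])).
  exists ti, (Node tf ta); split=> //; exists tf, ta; split=> //.
  by apply/(code_mx_familyE _ (MxFamily (trans B))).
exists u => //; apply/code_mx_familyE; move: uC => /=.
have -> : mxl (initial B) = [seq rowl v | v <- [:: initial B]].
  rewrite mxlE enum_ordSl enum_ord0 /=; congr [:: rowl _].
  by apply/rowP => j; rewrite mxE.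
have -> : [:: flatten (mxl (final B))] = [seq rowl v | v <- [:: (final B)^T]].
  congr [:: _]; rewrite /mxl enum_ordSl enum_ord0 /= /rowl.
  by elim: (enum _) => //= i s ->; rewrite mxE.
by rewrite reducel_family.
Qed.

Lemma MatrixProductContinuity_reducible :
  reducible (MatrixProductContinuity num) (MatrixProductStability num).
Proof.
apply: (reducible_by (X := MatrixProductContinuity num)
  (Y := MatrixProductStability num) (f := fun A : mx_family R =>
     let e := [seq row i 1%:M | i <- enum 'I_(mf_dim A)] in
     reduced_family (@mf_mx R A) e e)); last first.
  by move=> A; exact: continuous_RCPP.
(* The dimension of the identity is read off the first matrix, which exists because the alphabet is
   nonempty. *)
have [p hp] : computable (fun As : seq (seq (seq R)) =>
    reducel As (idl (head [::] As)) (idl (head [::] As))).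
  have hid : computable (fun As : seq (seq (seq R)) => idl (head [::] As)).
    apply: (computable_comp (computable_idl arith)).
    by apply: computable_head; exact: computable_id.
  by apply: (computable_comp3 (computable_reducel arith)) => //; exact: computable_id.
exists p => O t A /code_mx_familyE At; have [u pu uC] := hp O t _ At.
exists u => //; apply/code_mx_familyE; move: uC => /=.
have -> : idl (head [::] [seq mxl (@mf_mx R A a) | a <- enum 'I_(mf_letters A).+1]) =
    [seq rowl v | v <- [seq row i 1%:M | i <- enum 'I_(mf_dim A)]].
  by rewrite enum_ordSl /= idl_mxl mxlE -map_comp.
by rewrite reducel_family.
Qed.

End Reducibility.

Theorem theorem49 (R : realType) (num : tree -> option R)
    (arith : exact_arithmetic num) :
  reducible (ApWFAContinuity num) (MatrixProductStability num) /\
  reducible (MatrixProductContinuity num) (MatrixProductStability num).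
Proof.
split; [exact: ApWFAContinuity_reducible|exact: MatrixProductContinuity_reducible].
Qed.
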